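(* Let $H$ be a linear subspace of $\mathbb{R}^n$. Then the function $$(t_1,\ldots,t_n) \mapsto \mathrm{vol}_H\left(\mathrm{diag}(e^{t_1},\ldots,e^{t_n})B_1^n \cap H\right)$$ is log-concave on $\mathbb{R}^n$.
   Context: $B_1^n = \{x \in \mathbb{R}^n : \sum_{i=1}^n |x_i| \leq 1\}$ is the cross-polytope. $\mathrm{diag}(e^{t_1},\ldots,e^{t_n})$ is the $n\times n$ diagonal matrix with diagonal entries $e^{t_1},\ldots,e^{t_n}$, and $\mathrm{diag}(e^{t_1},\ldots,e^{t_n})B_1^n$ is the image of $B_1^n$ under this matrix. $\mathrm{vol}_H$ is Lebesgue measure on $H$ (i.e. $\dim H$-dimensional volume with respect to the Euclidean structure inherited from $\mathbb{R}^n$; for $H=\{0\}$ it is the counting measure). A function $f:\mathbb{R}^n\to[0,\infty)$ is log-concave if $f(\lambda s+(1-\lambda)t)\ge f(s)^{\lambda}f(t)^{1-\lambda}$ for all $s,t\in\mathbb{R}^n$ and $\lambda\in(0,1)$. *)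

(* Defs.v *)
From HB Require Import structures.
From mathcomp Require Import all_boot all_order all_algebra.
From mathcomp Require Import all_classical all_reals all_analysis.

Set Implicit Arguments.
Unset Strict Implicit.
Unset Printing Implicit Defensive.

Import Order.TTheory GRing.Theory Num.Theory.

Local Open Scope classical_set_scope.
Local Open Scope ring_scope.

(* Lebesgue measure on R^d, as a measure on d-tuples: the image of the product
   of the Lebesgue measures on R and on R^d under (x, v) |-> x :: v, starting
   from the unit mass (that is, the counting measure) on the one-point space
   R^0. *)
Section lebesgue_tuple.
Context {R : realType}.
Local Notation RT := (measurableTypeR R).

Section step.
Context (d : nat) (mu : {sigma_finite_measure set (d.-tuple RT) -> \bar R}).

Let consp (p : RT * d.-tuple RT) : d.+1.-tuple RT := [tuple of p.1 :: p.2].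

Let measurable_consp : measurable_fun setT consp.
Proof. exact: measurable_cons. Qed.

Definition lebesgue_tupleS : set (d.+1.-tuple RT) -> \bar R :=
  pushforward (lebesgue_measure \x mu)%E (fun p => [tuple of p.1 :: p.2]).

Let mS : {measure set (d.+1.-tuple RT) -> \bar R} :=
  measure_function_pushforward__canonical__measure_function_Measure
    (lebesgue_measure \x mu)%E measurable_consp.

HB.instance Definition _ := isMeasure.Build _ _ _ lebesgue_tupleS
  (measure0 mS) (measure_ge0 mS) (@measure_semi_sigma_additive _ _ _ mS).

Let sigma_finite_lebesgue_tupleS : sigma_finite setT lebesgue_tupleS.
Proof.
have /sigma_finiteP[F [FT ndF Foo]] := sigma_finiteT (@lebesgue_measure R).
have /sigma_finiteP[G [GT ndG Goo]] := sigma_finiteT mu.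
pose g (v : d.+1.-tuple RT) : RT * d.-tuple RT :=
  (thead v, [tuple of behead v]).
have mg : measurable_fun setT g.
  apply: measurable_fun_pair.
  - exact: measurable_tnth.
  - exact: measurable_behead.
have gK p : g (consp p) = p.
  by case: p => x v; congr pair; exact/val_inj.
exists (fun k => g @^-1` (F k `*` G k)).
  apply/seteqP; split => // v _.
  have [i _ Fi] : (\bigcup_k F k) (g v).1 by rewrite -FT.
  have [j _ Gj] : (\bigcup_k G k) (g v).2 by rewrite -GT.
  exists (maxn i j) => //; split.
  - by move: Fi; exact/subsetPset/ndF/leq_maxl.
  - by move: Gj; exact/subsetPset/ndG/leq_maxr.
move=> k; have [mF Fk] := Foo k; have [mG Gk] := Goo k; split.
  by rewrite -[X in measurable X]setTI; apply: mg => //; exact: measurableX.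
rewrite /lebesgue_tupleS /pushforward.
rewrite [X in (_ \x _)%E X](_ : _ = F k `*` G k); last first.
  by apply/funext => p; exact: (congr1 (F k `*` G k) (gK p)).
by rewrite product_measure1E// lte_mul_pinfty// ge0_fin_numE.
Qed.

HB.instance Definition _ := Measure_isSigmaFinite.Build _ _ _
  lebesgue_tupleS sigma_finite_lebesgue_tupleS.

End step.

Fixpoint lebesgue_tuple (d : nat) :
    {sigma_finite_measure set (d.-tuple RT) -> \bar R} :=
  match d with
  | 0 => \d_([tuple] : 0.-tuple RT)
  | d'.+1 => lebesgue_tupleS (lebesgue_tuple d')
  end.

End lebesgue_tuple.

Section subspace_volume.
Context {R : realType} {n : nat}.
Local Notation V := 'rV[R]_n.
Implicit Types (u v w : V) (H : {vspace V}) (A : set V).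

Definition dotv u v : R := \sum_i u ord0 i * v ord0 i.

Definition orthonormal_basis H (e : (\dim H).-tuple V) : Prop :=
  <<e>>%VS = H /\ forall i j, dotv (tnth e i) (tnth e j) = (i == j)%:R.

Let dotvC u v : dotv u v = dotv v u.
Proof. by apply: eq_bigr => i _; rewrite mulrC. Qed.

Let dotvDl u v w : dotv (u + v) w = dotv u w + dotv v w.
Proof. by rewrite -big_split; apply: eq_bigr => i _; rewrite mxE mulrDl. Qed.

Let dotvZl (a : R) u v : dotv (a *: u) v = a * dotv u v.
Proof. by rewrite mulr_sumr; apply: eq_bigr => i _; rewrite mxE mulrA. Qed.

Let dot0v u : dotv 0 u = 0.
Proof. by rewrite -(scale0r 0) dotvZl mul0r. Qed.

Let dotv_suml (I : Type) (r : seq I) (F : I -> V) u :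
  dotv (\sum_(i <- r) F i) u = \sum_(i <- r) dotv (F i) u.
Proof.
by elim/big_rec2: _ => [|i y x _ IH]; rewrite ?dot0v// dotvDl IH.
Qed.

Let dotv_gt0 u : u != 0 -> 0 < dotv u u.
Proof.
move=> u0; rewrite lt_neqAle sumr_ge0 ?andbT => [|i _]; last exact: sqr_ge0.
apply: contraNneq u0 => /esym /eqP.
rewrite psumr_eq0 => [/allP u0|i _]; last exact: sqr_ge0.
apply/eqP/rowP => i; rewrite mxE; apply/eqP.
by have := u0 i (mem_index_enum i); rewrite mulf_eq0 orbb.
Qed.

Let orthoseq (e : seq V) := forall i j, (i < size e)%N -> (j < size e)%N ->
  dotv e`_i e`_j = (i == j)%:R.

Let gram_schmidt (X : seq V) :
  exists e : seq V, <<e>>%VS = <<X>>%VS /\ orthoseq e.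
Proof.
elim: X => [|v X [e [es oe]]]; first by exists [::].
pose p := \sum_(k < size e) dotv v e`_k *: e`_k.
have pe : p \in <<e>>%VS.
  by apply: memv_suml => k _; apply/memvZ/memv_span/mem_nth.
pose w := v - p.
have we j : (j < size e)%N -> dotv w e`_j = 0.
  move=> je; rewrite dotvDl -scaleN1r dotvZl mulN1r dotv_suml.
  rewrite (bigD1 (Ordinal je))//= big1 => [|k kj]; last first.
    by rewrite dotvZl oe// -val_eqE/= in kj * => //; rewrite (negbTE kj) mulr0.
  by rewrite dotvZl oe// eqxx mulr1 addr0 subrr.
have vE : v = w + p by rewrite subrK.
have [w0|w0] := eqVneq w 0.
  exists e; split => //; rewrite span_cons -es; apply/esym/addv_idPr.
  by rewrite -memvE vE w0 add0r.
pose c := (Num.sqrt (dotv w w))^-1.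
have c0 : c != 0 by rewrite invr_eq0 sqrtr_eq0 -ltNge dotv_gt0.
exists (c *: w :: e); split.
  rewrite !span_cons -es; apply/eqP; rewrite eqEsubv !subv_add !addvSr !andbT.
  apply/andP; split; rewrite -memvE.
    apply/memvZ/memvB; first by rewrite memvE addvSl.
    by move: pe; apply/subvP; exact: addvSr.
  rewrite vE; apply: memvD.
    rewrite -[X in X \in _]scale1r -(mulVf c0) -scalerA; apply: memvZ.
    by rewrite memvE addvSl.
  by move: pe; apply/subvP; exact: addvSr.
case=> [|i] [|j] //=; rewrite ?ltnS => ie je.
- rewrite dotvZl dotvC dotvZl mulrA -expr2 exprVn sqr_sqrtr ?mulVf//.
    by rewrite gt_eqF// dotv_gt0.
  by rewrite ltW// dotv_gt0.
- by rewrite dotvZl we// mulr0.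
- by rewrite dotvC dotvZl we// mulr0.
- by rewrite oe.
Qed.

Lemma orthonormal_basis_exists H : exists e, @orthonormal_basis H e.
Proof.
have [e []] := gram_schmidt (vbasis H).
rewrite (span_basis (vbasisP H)) => eH oe.
have fe : free e.
  rewrite -[e]in_tupleE; apply/freeP => k ke i.
  have := congr1 (dotv^~ e`_i) ke; rewrite dot0v dotv_suml (bigD1 i)//= big1.
    by rewrite dotvZl oe// eqxx mulr1 addr0.
  move=> j ji; rewrite dotvZl oe//.
  by rewrite val_eqE (negbTE ji) mulr0.
have se : size e == \dim H by rewrite -eH eq_sym; exact: fe.
exists (Tuple se); split => // i j.
rewrite !(tnth_nth 0)/= oe ?val_eqE//; by rewrite (eqP se).
Qed.

(* vol_H: d-dimensional Lebesgue measure, d = \dim H, in the coordinates given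
   by an orthonormal basis of H. By invariance of Lebesgue measure under
   orthogonal maps, the value does not depend on the basis that is chosen. *)
Definition onb H : (\dim H).-tuple V := sval (cid (orthonormal_basis_exists H)).

Lemma onbP H : orthonormal_basis (onb H).
Proof. exact: svalP (cid (orthonormal_basis_exists H)). Qed.

Definition vol H A : \bar R :=
  lebesgue_tuple (\dim H) [set c | A (\sum_i tnth c i *: tnth (onb H) i)].

End subspace_volume.

Definition cross_polytope (R : realType) (n : nat) : set 'rV[R]_n :=
  [set x | \sum_i `|x ord0 i| <= 1].

(* Vectors are rows, so that a (diagonal) matrix acts on the right. *)
Definition scaled_cross_polytope (R : realType) (n : nat) (t : 'rV[R]_n) :
    set 'rV[R]_n :=
  [set x *m diag_mx (map_mx expR t) | x in @cross_polytope R n].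

(* 0 `^ a = 0 for 0 < a, so the inequality is trivial when f s = 0 or f t = 0. *)
Definition log_concave (R : realType) (n : nat) (f : 'rV[R]_n -> R) : Prop :=
  (forall t, 0 <= f t) /\
  forall (s t : 'rV[R]_n) (a : R), 0 < a < 1 ->
    f s `^ a * f t `^ (1 - a) <= f (a *: s + (1 - a) *: t).

(* Main.v *)
From HB Require Import structures.
Require Import Defs.
From mathcomp Require Import all_boot all_order all_algebra fingroup perm.
From mathcomp Require Import all_classical all_reals all_analysis.
From mathcomp Require Import measurable_realfun ring lra.

Set Implicit Arguments.
Unset Strict Implicit.
Unset Printing Implicit Defensive.

Import Order.TTheory GRing.Theory Num.Theory.
Import numFieldNormedType.Exports.

Local Open Scope classical_set_scope.
Local Open Scope ring_scope.

(* Up to a constant factor independent of t, the volume of the section is the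
   integral over H of exp(-2 sum_i e^(-t_i) |x_i|), so it suffices to show that
   this integral is log-concave in w = -t. Write c for coordinates of x in an
   orthonormal basis of H. If every term 2 e^(w_i) |x_i| is replaced by
   e^(2 w_i) x_i^2, the integral is Gaussian, equal to a constant times
   det(sum_i e^(2 w_i) v_i^T v_i)^(-1/2); that determinant is a combination of
   exponentials of linear forms in w with nonnegative coefficients, so it is
   log-convex by Hoelder. The Laplace kernel is the mixture of Gaussian kernels
     exp(-2 e^w |x|) = C \int_r exp(r - e^(2r)) exp(-(e^(w-r) x)^2) dr,
   whose mixing weight is log-concave in r. Passing from x_i^2 to |x_i| in one
   coordinate is thus a one-dimensional marginal of a function that is jointly
   log-concave in (w, r), and it preserves log-concavity by the
   Prekopa-Leindler inequality on the line. *)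

(** * Gram determinants *)

(** Prekopa-Leindler cannot be applied directly over H: [e^(w_i) |x_i|] is not jointly convex in w_i
    and x_i, and the substitution [x_i = e^(u_i)], which would make it convex, does not keep H
    linear. The Gaussian exponent is not jointly convex either, but its integral over H is explicit,
    so that its log-concavity becomes a fact about determinants. The mixing variable r enters the
    Gaussian factor only through [w_i - r], so an inequality known for all w is automatically joint
    in w and r. Switching one coordinate at a time introduces one new variable at a time, which is
    why Prekopa-Leindler is needed on the line only. The mixture formula is the classical integral
    over u > 0 of exp(-u^2 - y^2/u^2), equal to (sqrt pi / 2) e^(-2|y|), written with u = e^r. It
    accounts for the 2 in the exponential weight and, through du = e^r dr, for the factor e^r in the
    mixing weight; being log-affine, that factor does no harm. *)

(* Expanding by multilinearity gives a sum over all maps f : 'I_d -> 'I_n; a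
   square appears once that sum is averaged over f \o s for s : 'S_d. *)
Lemma det_gram (R : comPzRingType) (d n : nat) (V : 'M[R]_(d, n))
    (l : 'rV[R]_n) :
  (d`!)%:R * \det (V *m diag_mx l *m V^T) =
  \sum_(f : {ffun 'I_d -> 'I_n})
    (\prod_j l ord0 (f j)) * (\det (colsub f V)) ^+ 2.
Proof.
pose F (f : {ffun 'I_d -> 'I_n}) := \prod_j l ord0 (f j).
have detE : \det (V *m diag_mx l *m V^T) =
    \sum_(f : {ffun 'I_d -> 'I_n})
      F f * (\prod_j V j (f j)) * \det (colsub f V).
  under [RHS]eq_bigr do rewrite -det_tr mulr_sumr.
  rewrite exchange_big /=; apply: eq_bigr => u _.
  transitivity ((-1) ^+ u * \prod_j \sum_i V j i * l ord0 i * V (u j) i).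
    congr (_ * _); apply: eq_bigr => j _; rewrite mxE; apply: eq_bigr => i _.
    by rewrite mul_mx_diag !mxE.
  rewrite bigA_distr_bigA mulr_sumr; apply: eq_bigr => f _.
  rewrite !big_split/= mulrCA [F f * _]mulrC; congr (_ * (_ * _)).
  by apply: eq_bigr => j _; rewrite !mxE.
(* Precomposing f with s permutes the columns: the determinant picks up the sign of s, while the
   product of the [l] is unchanged. Summed over s, the remaining signed products form a second copy
   of the determinant. *)
have detS (s : 'S_d) : \det (V *m diag_mx l *m V^T) =
    \sum_(f : {ffun 'I_d -> 'I_n})
      F f * ((-1) ^+ s * \prod_j V j (f (s j))) * \det (colsub f V).
  rewrite detE (reindex_inj (h := fun f : {ffun 'I_d -> 'I_n} =>
    [ffun j => f (s j)])) /=.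
    apply: eq_bigr => f _.
    have -> : F [ffun j => f (s j)] = F f.
      rewrite /F [RHS](reindex_inj (@perm_inj _ s)).
      by apply: eq_bigr => j _; rewrite ffunE.
    have -> : colsub [ffun j => f (s j)] V = col_perm s (colsub f V).
      by apply/matrixP => i j; rewrite !mxE ffunE.
    rewrite col_permE det_mulmx det_perm.
    under eq_bigr do rewrite ffunE.
    rewrite (mulrC (_ ^+ _)) -!mulrA; congr (_ * (_ * _)).
    by rewrite mulrC odd_permV.
  move=> f g /ffunP fg; apply/ffunP => j.
  by have := fg (s^-1 j)%g; rewrite !ffunE permKV.
rewrite -card_Sn mulr_natl -sumr_const.
under eq_bigr => s _ do rewrite (detS s).
rewrite exchange_big /=; apply: eq_bigr => f _.
rewrite -mulr_suml -mulr_sumr -mulrA expr2; congr (_ * (_ * _)).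
by apply: eq_bigr => s _; congr (_ * _); apply: eq_bigr => j _; rewrite !mxE.
Qed.

(** Young's inequality for the conjugate exponents 1/a and 1/(1-a). *)
Lemma weighted_AMGM (R : realType) (x y a : R) :
  0 <= x -> 0 <= y -> 0 < a < 1 -> x `^ a * y `^ (1 - a) <= a * x + (1 - a) * y.
Proof.
move=> x0 y0 /andP[a0 a1].
have b0 : 0 < 1 - a by rewrite subr_gt0.
have := @conjugate_powR R (x `^ a) (y `^ (1 - a)) a^-1 (1 - a)^-1.
rewrite -!powRrM !invrK !divff ?gt_eqF// !powRr1// ![_ * x]mulrC ![_ * y]mulrC.
by apply; rewrite ?powR_ge0 ?invr_gt0// addrC subrK.
Qed.

(** After division by the two sums this is weighted AM-GM, term by term. A zero sum has to be
    treated apart; it forces every term to vanish. *)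
Lemma holder_sum (R : realType) (I : finType) (x y : I -> R) (a : R) :
  (forall i, 0 <= x i) -> (forall i, 0 <= y i) -> 0 < a < 1 ->
  \sum_i x i `^ a * y i `^ (1 - a) <=
  (\sum_i x i) `^ a * (\sum_i y i) `^ (1 - a).
Proof.
move=> x0 y0 a01; have /andP[a0 a1] := a01.
have b0 : 0 < 1 - a by rewrite subr_gt0.
set X := \sum_i x i; set Y := \sum_i y i.
have [X0|X0] := eqVneq X 0.
  rewrite X0 powR0 ?gt_eqF// mul0r big1// => i _.
  move/eqP: X0; rewrite psumr_eq0// => /allP/(_ i (mem_index_enum _))/eqP ->.
  by rewrite powR0 ?gt_eqF// mul0r.
have [Y0|Y0] := eqVneq Y 0.
  rewrite Y0 powR0 ?gt_eqF// mulr0 big1// => i _.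
  move/eqP: Y0; rewrite psumr_eq0// => /allP/(_ i (mem_index_enum _))/eqP ->.
  by rewrite [X in _ * X]powR0 ?gt_eqF// mulr0.
have Xp : 0 < X by rewrite lt_def X0 sumr_ge0.
have Yp : 0 < Y by rewrite lt_def Y0 sumr_ge0.
have -> : \sum_i x i `^ a * y i `^ (1 - a) =
    X `^ a * Y `^ (1 - a) * \sum_i (x i / X) `^ a * (y i / Y) `^ (1 - a).
  rewrite mulr_sumr; apply: eq_bigr => i _.
  by rewrite mulrACA -!powRM ?divr_ge0// 1?ltW// ![_ * (_ / _)]mulrC !divfK.
rewrite ler_piMr ?mulr_ge0 ?powR_ge0//.
apply: (@le_trans _ _ (\sum_i (a * (x i / X) + (1 - a) * (y i / Y)))).
  by apply: ler_sum => i _; apply: weighted_AMGM => //; rewrite divr_ge0// ltW.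
by rewrite big_split/= -!mulr_sumr -!mulr_suml !divff// !mulr1 addrC subrK.
Qed.

Lemma det_gram_log_convex (R : realType) (d n : nat) (V : 'M[R]_(d, n))
    (s t : 'rV[R]_n) (a : R) : 0 < a < 1 ->
  \det (V *m diag_mx (map_mx expR (a *: s + (1 - a) *: t)) *m V^T) <=
  \det (V *m diag_mx (map_mx expR s) *m V^T) `^ a *
  \det (V *m diag_mx (map_mx expR t) *m V^T) `^ (1 - a).
Proof.
move=> a01; have /andP[a0 a1] := a01.
pose D u := \det (V *m diag_mx (map_mx expR u) *m V^T).
rewrite -/(D s) -/(D t) -/(D (_ + _)).
have d0 : 0 < d`!%:R :> R by rewrite ltr0n fact_gt0.
have di0 : 0 <= d`!%:R^-1 :> R by rewrite invr_ge0 ltW.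
have prodE (u : 'rV[R]_n) (f : {ffun 'I_d -> 'I_n}) :
    \prod_j map_mx expR u ord0 (f j) = expR (\sum_j u ord0 (f j)).
  by rewrite expR_sum; apply: eq_bigr => j _; rewrite mxE.
have DE u : D u = \sum_(f : {ffun 'I_d -> 'I_n})
    d`!%:R^-1 * expR (\sum_j u ord0 (f j)) * (\det (colsub f V)) ^+ 2.
  rewrite -[LHS](mulKf (lt0r_neq0 d0)) det_gram mulr_sumr.
  by apply: eq_bigr => f _; rewrite prodE mulrA.
have D0 (u : 'rV[R]_n) (f : {ffun 'I_d -> 'I_n}) :
    0 <= d`!%:R^-1 * expR (\sum_j u ord0 (f j)) * \det (colsub f V) ^+ 2.
  by rewrite mulr_ge0 ?sqr_ge0// mulr_ge0 ?expR_ge0// invr_ge0 ltW.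
rewrite !DE; apply: le_trans (holder_sum _ _ a01) => //.
(* Exponentials of linear forms are log-affine, so the two sides agree term by term: Hoelder is the
   only loss. *)
rewrite le_eqVlt; apply/orP; left; apply/eqP; apply: eq_bigr => f _.
set c := \det _ ^+ 2; have c0 : 0 <= c by exact: sqr_ge0.
move: c c0 (d`!%:R^-1) di0 => c c0 k k0; rewrite !powRM ?mulr_ge0 ?expR_ge0//.
rewrite [RHS]mulrACA [X in _ = X * _]mulrACA.
have powR1D (x : R) : 0 <= x -> x `^ a * x `^ (1 - a) = x.
  by move=> x0; rewrite -powRD addrC subrK ?oner_eq0// powRr1.
rewrite !powR1D//; congr (_ * _ * _).
rewrite -!expRM -expRD; congr expR; rewrite !mulr_suml -big_split.
by apply: eq_bigr => j _; rewrite !mxE mulrC [X in _ + X]mulrC.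
Qed.

(** * Lebesgue measure on tuples *)

Section affine_substitution.
Context {R : realType}.
Local Notation mu := (@lebesgue_measure R).
Local Open Scope ereal_scope.

(** By uniqueness of Lebesgue measure it is enough to compare both sides on half-open intervals. *)
Lemma lebesgue_measure_affine (a b : R) (A : set (measurableTypeR R)) :
  (0 < a)%R -> measurable A ->
  mu ((fun x : R => (a * x + b)%R) @^-1` A) = (a^-1)%:E * mu A.
Proof.
move=> a0 mA.
have mf : measurable_fun [set: measurableTypeR R]
    (fun x : R => (a * x + b)%R : measurableTypeR R).
  by apply: measurable_funD => //; exact: measurable_funM.
pose nu : {measure set (measurableTypeR R) -> \bar R} :=
  mscale (NngNum (ltW a0))
   (measure_function_pushforward__canonical__measure_function_Measure mu mf).
suff -> : mu A = nu A.
  rewrite /nu /mscale/= /pushforward muleA -EFinM mulVf ?mul1e//.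
  by rewrite gt_eqF.
apply: lebesgue_measure_unique => //= _ [[x y]] _ <-.
rewrite /nu /mscale/= /pushforward.
rewrite (_ : _ @^-1` _ = `](x - b) / a, (y - b) / a]%classic)%R; last first.
  apply/seteqP; split => z/=;
    rewrite !in_itv/= ltr_pdivrMr// ler_pdivlMr// ltrBlDr lerBrDr (mulrC z)//.
rewrite !lebesgue_measure_itv/= !lte_fin ltr_pM2r ?invr_gt0// ltrD2r.
case: ifPn => _; last by rewrite mule0.
rewrite -!EFinB -EFinM; congr EFin.
have : a != 0%R by rewrite gt_eqF.
by move=> a_neq0; field.
Qed.

Lemma ge0_integral_affine (a b : R) (f : R -> \bar R) : (0 < a)%R ->
  measurable_fun [set: R] f -> (forall x, 0 <= f x) ->
  \int[mu]_x f (a * x + b)%R = (a^-1)%:E * \int[mu]_x f x.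
Proof.
move=> a0 mf f0.
have mh : measurable_fun [set: measurableTypeR R]
    (fun x : R => (a * x + b)%R : measurableTypeR R).
  by apply: measurable_funD => //; exact: measurable_funM.
have ai0 : (0 < a^-1)%R by rewrite invr_gt0.
transitivity (\int[pushforward mu
    (fun x : R => (a * x + b)%R : measurableTypeR R)]_x f x).
  by rewrite ge0_integral_pushforward.
rewrite -(@ge0_integral_mscale _ _ _ _ _ _ (NngNum (ltW ai0)))//.
apply: eq_measure_integral => A mA _.
exact: lebesgue_measure_affine.
Qed.

Lemma integral_gauss_affine (m b : R) : (0 < m)%R ->
  \int[mu]_x (expR (- (m * (x + b) ^+ 2)))%:E = (Num.sqrt (pi / m))%:E.
Proof.
move=> m0.
have sm0 : (0 < Num.sqrt m)%R by rewrite sqrtr_gt0.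
transitivity (\int[mu]_x (gauss_fun (Num.sqrt m * x + Num.sqrt m * b)%R)%:E).
  apply: eq_integral => x _; congr (expR (- _))%:E.
  by rewrite -mulrDr exprMn sqr_sqrtr// ltW.
rewrite (ge0_integral_affine _ _ (f := fun x => (gauss_fun x)%:E))//.
- by rewrite integralT_gauss -EFinM sqrtrM ?pi_ge0// mulrC sqrtrV// ltW.
- by apply/measurable_EFinP; exact: measurable_gauss_fun.
- by move=> x; rewrite lee_fin gauss_fun_ge0.
Qed.

End affine_substitution.

Section integral_lebesgue_tuple.
Context {R : realType}.
Local Notation RT := (measurableTypeR R).
Local Notation mu := (@lebesgue_measure R).
Local Open Scope ereal_scope.

Lemma integral_lebesgue_tuple0 (f : 0.-tuple RT -> \bar R) :
  measurable_fun setT f ->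
  \int[lebesgue_tuple 0]_c f c = f [tuple].
Proof.
by move=> mf; rewrite /= integral_dirac// diracE mem_set// mul1e.
Qed.

Lemma integral_lebesgue_tupleS d (f : d.+1.-tuple RT -> \bar R) :
  measurable_fun setT f -> (forall c, 0 <= f c) ->
  \int[lebesgue_tuple d.+1]_c f c =
  \int[lebesgue_tuple d]_c \int[mu]_x f [tuple of x :: c].
Proof.
move=> mf f0.
have mh : measurable_fun setT
    (fun p : RT * d.-tuple RT => [tuple of p.1 :: p.2] : d.+1.-tuple RT).
  exact: measurable_cons.
rewrite [LHS](_ : _ = \int[pushforward (mu \x lebesgue_tuple d)
  (fun p : RT * d.-tuple RT => [tuple of p.1 :: p.2])]_c f c)//.
rewrite ge0_integral_pushforward// preimage_setT.
rewrite (fubini_tonelli2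
  (fun p : RT * d.-tuple RT => f [tuple of p.1 :: p.2]))//.
exact: measurableT_comp.
Qed.

(** Tonelli peels off the coordinates, each contributing a factor [s^-1]. The homogeneity of section
    volumes rests on this. *)
Lemma ge0_integral_lebesgue_tuple_scale d (s : R) (f : d.-tuple RT -> \bar R) :
  (0 < s)%R -> measurable_fun setT f -> (forall c, 0 <= f c) ->
  \int[lebesgue_tuple d]_c f [tuple of map ( *%R s) c] =
  (s ^- d)%:E * \int[lebesgue_tuple d]_c f c.
Proof.
move=> s0.
have mmap n : measurable_fun setT
    (fun c : n.-tuple RT => [tuple of map ( *%R s) c] : n.-tuple RT).
  apply/measurable_fun_tnthP => i.
  rewrite (_ : _ \o _ = fun c : n.-tuple RT => (s * tnth c i)%R); last first.
    by apply/funext => c /=; rewrite tnth_map.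
  by apply: measurable_funM => //; exact: measurable_tnth.
elim: d f => [|d IH] f mf f0.
  rewrite !integral_lebesgue_tuple0//; last first.
    exact: (measurableT_comp mf (mmap _)).
  by rewrite expr0 invr1 mul1e; congr f; exact/val_inj.
rewrite !integral_lebesgue_tupleS//; last exact: (measurableT_comp mf (mmap _)).
transitivity (\int[lebesgue_tuple d]_c ((s^-1)%:E * \int[mu]_x
    f [tuple of x :: [tuple of map ( *%R s) c]])).
  apply: eq_integral => c _.
  rewrite -(ge0_integral_affine 0%R _ (f := fun x => f [tuple of x :: _]))//.
    apply: eq_integral => x _; congr f; apply/val_inj => /=.
    by rewrite addr0.
  apply: (measurableT_comp mf).
  exact: measurable_cons.
have mF : measurable_fun setT
    (fun c : d.-tuple RT => \int[mu]_x f [tuple of x :: c]).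
  apply: (measurable_fun_fubini_tonelli_G (m1 := mu)
    (fun p : RT * d.-tuple RT => f [tuple of p.1 :: p.2])) => //.
  by apply: (measurableT_comp mf); exact: measurable_cons.
have F0 (c : d.-tuple RT) : 0 <= \int[mu]_x f [tuple of x :: c].
  exact: integral_ge0.
rewrite ge0_integralZl//; last 2 first.
- exact: (measurableT_comp mF (mmap d)).
- by rewrite lee_fin invr_ge0 ltW.
rewrite (IH (fun c => \int[mu]_x f [tuple of x :: c]))// muleA -EFinM.
by rewrite exprS invfM mulrC.
Qed.
End integral_lebesgue_tuple.

(** * Gaussian integrals *)

Section gaussian_quadratic_form.
Context {R : realType}.
Local Notation RT := (measurableTypeR R).
Local Notation mu := (@lebesgue_measure R).

Definition quadratic_form d (M : 'M[R]_d) (u : 'rV[R]_d) : R :=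
  (u *m M *m u^T) ord0 ord0.

Definition row_of_tuple d (c : d.-tuple RT) : 'rV[R]_d := \row_j tnth c j.

Lemma row_of_tuple_cons d (x : R) (c : d.-tuple RT) :
  row_of_tuple [tuple of x :: c] = row_mx x%:M (row_of_tuple c).
Proof.
apply/rowP => j; rewrite !mxE; case: splitP => k jk; rewrite !mxE.
  rewrite (_ : j = ord0) ?tnth0 ?ord1 ?eqxx//.
  by apply/val_inj; rewrite /= jk ord1.
by rewrite (_ : j = lift ord0 k) ?tnthS//; exact/val_inj.
Qed.

Lemma measurable_row_of_tuple d j :
  measurable_fun setT (fun c : d.-tuple RT => row_of_tuple c ord0 j : RT).
Proof.
by under eq_fun do rewrite mxE; exact: measurable_tnth.
Qed.

Lemma measurable_row_of_tuple_mulmx d n (A : 'M[R]_(d, n)) j :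
  measurable_fun setT
    (fun c : d.-tuple RT => (row_of_tuple c *m A) ord0 j : RT).
Proof.
under eq_fun do rewrite mxE.
apply: measurable_sum => i; apply: measurable_funM => //.
exact: measurable_row_of_tuple.
Qed.

Lemma measurable_quadratic_form d (M : 'M[R]_d) :
  measurable_fun setT
    (fun c : d.-tuple RT => quadratic_form M (row_of_tuple c) : RT).
Proof.
under eq_fun do rewrite /quadratic_form mxE.
apply: measurable_sum => i; apply: measurable_funM => //.
  exact: measurable_row_of_tuple_mulmx.
by under eq_fun do rewrite mxE; exact: measurable_row_of_tuple.
Qed.

Lemma measurable_exp_quadratic_form d (M : 'M[R]_d) :
  measurable_fun setT (fun c : d.-tuple RT =>
    (expR (- quadratic_form M (row_of_tuple c)))%:E).
Proof.
apply/measurable_EFinP; apply: (measurableT_comp (@measurable_expR R)).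
by apply: measurable_funN; exact: measurable_quadratic_form.
Qed.

Lemma measurable_gauss_affine (m b : R) :
  measurable_fun setT (fun x : RT => (expR (- (m * (x + b) ^+ 2)))%:E).
Proof.
apply/measurable_EFinP; apply: (measurableT_comp (@measurable_expR R)).
apply: measurable_funN; apply: measurable_funM => //; apply: measurable_funX.
exact: measurable_funD.
Qed.

Definition schur_complement d (M : 'M[R]_(1 + d)) : 'M[R]_d :=
  drsubmx M - (M ord0 ord0)^-1 *: ((ursubmx M)^T *m ursubmx M).

Lemma block_mx_symmetric d (M : 'M[R]_(1 + d)) : M^T = M ->
  M = block_mx (M ord0 ord0)%:M (ursubmx M) (ursubmx M)^T (drsubmx M).
Proof.
move=> sM; rewrite -{1}[M]submxK trmx_ursub sM; congr block_mx.
apply/matrixP => i j; rewrite !ord1 !mxE eqxx mulr1n.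
by congr (M _ _); exact/val_inj.
Qed.

(** Block LU factorization, with a unipotent lower factor. *)
Lemma det_schur_complement d (M : 'M[R]_(1 + d)) : M^T = M ->
  M ord0 ord0 != 0 -> \det M = M ord0 ord0 * \det (schur_complement M).
Proof.
move=> sM m0; set m := M ord0 ord0; set B := ursubmx M.
have -> : \det M = \det (block_mx (1%:M : 'M[R]_1) 0 (m^-1 *: B^T) 1%:M *m
    block_mx m%:M B 0 (schur_complement M)).
  rewrite mulmx_block !mul1mx !mul0mx !addr0.
  rewrite -scalemxAl mul_mx_scalar scalerA mulVf// scale1r -scalemxAl.
  by rewrite subrKC -block_mx_symmetric.
by rewrite det_mulmx det_lblock det_ublock !det1 !mul1r det_scalar1.
Qed.

(** Completion of the square in the first coordinate. *)
Lemma quadratic_form_schur_complement d (M : 'M[R]_(1 + d)) x v : M^T = M ->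
  M ord0 ord0 != 0 ->
  quadratic_form M (row_mx x%:M v) =
  M ord0 ord0 * (x + (v *m (ursubmx M)^T) ord0 ord0 / M ord0 ord0) ^+ 2 +
  quadratic_form (schur_complement M) v.
Proof.
move=> sM m0; rewrite /quadratic_form {1}(block_mx_symmetric sM).
rewrite tr_row_mx mul_row_block mul_row_col !mulmxDl /schur_complement.
rewrite mulmxBr mulmxBl -scalemxAr -scalemxAl mulmxA.
set B := ursubmx M; set m := M ord0 ord0.
have -> : v *m B^T *m B *m v^T = (v *m B^T) *m (v *m B^T)^T.
  by rewrite trmx_mul trmxK mulmxA.
have -> : x%:M *m B *m v^T = x *: (v *m B^T)^T.
  by rewrite mul_scalar_mx -scalemxAl trmx_mul trmxK.
rewrite tr_scalar_mx !mul_mx_scalar.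
move: (v *m B^T) => b; move: (_ *m v^T) => q.
rewrite !mxE !big_ord1 !mxE eqxx mulr1n.
by field.
Qed.

Definition posdef d (M : 'M[R]_d) := forall u, u != 0 -> 0 < quadratic_form M u.

(** Induction by integrating out the first coordinate: the pivot [m] is a factor of the determinant
    and [sqrt (pi / m)] a factor of the integral, and what is left is the same problem for the Schur
    complement. *)
Lemma integral_gauss_quadratic_form d (M : 'M[R]_d) : M^T = M -> posdef M ->
  0 < \det M /\
  (\int[lebesgue_tuple d]_c (expR (- quadratic_form M (row_of_tuple c)))%:E =
   (Num.sqrt pi ^+ d / Num.sqrt (\det M))%:E)%E.
Proof.
elim: d M => [|d IH] M sM pM.
  rewrite det_mx00 sqrtr1 expr0 divr1 integral_lebesgue_tuple0//.
    by rewrite /quadratic_form mxE big_ord0 oppr0 expR0.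
  exact: measurable_exp_quadratic_form.
pose m := M ord0 ord0.
have m0 : 0 < m.
  have := pM (delta_mx ord0 ord0); rewrite /quadratic_form -rowE.
  rewrite (_ : (_ *m _) _ _ = m).
    apply; apply/eqP => /matrixP/(_ ord0 ord0)/eqP.
    by rewrite !mxE !eqxx oner_eq0.
  by rewrite trmx_delta -colE !mxE.
have mn0 : M ord0 ord0 != 0 by rewrite gt_eqF.
pose S := schur_complement (M : 'M[R]_(1 + d)).
have [] := IH S.
- rewrite /S /schur_complement raddfB/= linearZ/= trmx_mul trmxK; congr (_ - _).
  by rewrite trmx_drsub sM.
- move=> v v0.
  (* This first coordinate annihilates the completed square, so [M] and its Schur complement take
     the same value. *)
  have := pM (row_mx
    (- (v *m (ursubmx (M : 'M[R]_(1 + d)))^T) ord0 ord0 / m)%:M v).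
  rewrite (quadratic_form_schur_complement _ _ sM)//.
  rewrite mulNr addNr expr0n/= mulr0 add0r; apply.
  apply: contraNneq v0 => /(congr1 (@rsubmx R 1 1 d)).
  by rewrite row_mxKr => ->; apply/eqP/rowP => j; rewrite !mxE.
move=> dS IS; split; first by rewrite (det_schur_complement sM)// mulr_gt0.
rewrite (det_schur_complement sM)// -/m -/S integral_lebesgue_tupleS//; last first.
  exact: measurable_exp_quadratic_form.
transitivity (\int[lebesgue_tuple d]_c ((Num.sqrt (pi / m))%:E *
    (expR (- quadratic_form S (row_of_tuple c)))%:E))%E.
  apply: eq_integral => c _.
  under eq_integral => x _.
    rewrite row_of_tuple_cons (quadratic_form_schur_complement _ _ sM)//.
    rewrite opprD expRD EFinM.
    over.
  rewrite ge0_integralZr//; first by rewrite integral_gauss_affine.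
  exact: measurable_gauss_affine.
rewrite ge0_integralZl//; last exact: measurable_exp_quadratic_form.
rewrite IS -EFinM sqrtrM ?pi_ge0// sqrtrV ?(ltW m0)// sqrtrM ?(ltW m0)//.
by rewrite exprS invfM mulrACA (mulrC (Num.sqrt pi)).
Qed.

End gaussian_quadratic_form.

(** * Layer cake and Brunn-Minkowski for intervals *)

Section layer_cake.
Context d (T : measurableType d) {R : realType}.
Variable m : {sigma_finite_measure set T -> \bar R}.
Local Notation RT := (measurableTypeR R).
Local Notation mu := (@lebesgue_measure R).
Local Open Scope ereal_scope.
Variable f : T -> R.
Hypothesis mf : measurable_fun setT f.

Let hypograph : set (T * RT) := [set p | p.2 <= f p.1]%R.

Let measurable_hypograph : measurable hypograph.
Proof.
rewrite /hypograph -[X in measurable X]setTI.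
apply: (@measurable_fun_le _ _ R setT snd (f \o fst)) => //.
exact: measurableT_comp.
Qed.

Lemma measurable_superlevel (s : R) : measurable [set x | s <= f x]%R.
Proof.
rewrite -[X in measurable X]setTI.
exact: (@measurable_fun_le _ _ R setT (cst s) f).
Qed.

Lemma measurable_measure_superlevel :
  measurable_fun setT (fun s : RT => m [set x | s <= f x]%R).
Proof.
rewrite [X in measurable_fun _ X](_ : _ = m \o ysection hypograph).
  exact: measurable_fun_ysection.
apply/funext => s /=; congr (m _); apply/seteqP; split => x /=;
  by rewrite /ysection/= /hypograph inE.
Qed.

(** Tonelli on the region under the graph. Cutting at 1 confines the levels to []0, 1[]; it changes
    nothing for functions bounded by 1, and for any other function it gives a lower bound of the
    integral. *)
Lemma layer_cake : (forall x, 0 <= f x)%R ->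
  \int[m]_x (Num.min (f x) 1)%:E =
  \int[mu]_(s in `]0%R, 1%R[) m [set x | s <= f x]%R.
Proof.
move=> f0.
pose E : set (T * RT) := hypograph `&` snd @^-1` `]0%R, 1%R[.
have mE : measurable E.
  apply: measurableI => //; rewrite -[X in measurable X]setTI.
  exact: (measurable_snd measurableT).
transitivity (\int[m]_x \int[mu]_s (\1_E (x, s))%:E).
  apply: eq_integral => x _.
  rewrite (_ : (fun s => _) = fun s : RT => (\1_(xsection E x) s)%:E); last first.
    by apply/funext => s; rewrite !indicE mem_xsection.
  rewrite integral_indic ?setIT//; last exact: measurable_xsection.
  have [f1|f1] := ltP (f x) 1%R.
    rewrite (_ : xsection E x = `]0%R, f x]%classic).
      rewrite /= lebesgue_measure_itv/= lte_fin sube0; case: ltP => // fx0.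
      by congr EFin; apply/eqP; rewrite eq_le fx0 f0.
    apply/seteqP; split => s; rewrite /xsection /E /hypograph/= in_itv/=.
      by rewrite inE/= in_itv/= => -[-> /andP[-> _]].
    by move=> /andP[s0 sf]; rewrite inE/= in_itv/= s0 sf (le_lt_trans sf).
  rewrite (_ : xsection E x = `]0%R, 1%R[%classic).
    by rewrite /= lebesgue_measure_itv/= lte_fin ltr01 sube0.
  apply/seteqP; split => s; rewrite /xsection /E /hypograph/=;
    rewrite in_itv/= inE/= in_itv/=.
    by case.
  by move=> /andP[s0 s1]; rewrite s0 s1; split => //; rewrite (le_trans (ltW s1)).
rewrite (fubini_tonelli (fun p : T * RT => (\1_E p)%:E))//; last first.
  by apply/measurable_EFinP; exact: measurable_indic.
rewrite [RHS]integral_mkcond; apply: eq_integral => s _.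
rewrite (_ : (fun x => _) = fun x => (\1_(ysection E s) x)%:E); last first.
  by apply/funext => x; rewrite !indicE mem_ysection.
rewrite integral_indic ?setIT//; last exact: measurable_ysection.
rewrite patchE; case: ifPn => [/set_mem s01|/negP s01].
  congr (m _); apply/seteqP; split => x; rewrite /ysection /E /hypograph/= inE/=.
    by case.
  by split.
rewrite (_ : ysection E s = set0) ?measure0//; apply/seteqP; split => // x.
rewrite /ysection /E /hypograph/= inE/= => -[_ H].
by apply: s01; rewrite inE.
Qed.

End layer_cake.

Section brunn_minkowski_interval.
Context {R : realType}.
Local Notation mu := (@lebesgue_measure R).

(** The set is contained in [[inf A, inf A + r]]. *)
Lemma lebesgue_measure_diameter_le (A : set R) (r : R) : A !=set0 ->
  measurable A -> (forall x y, A x -> A y -> y - x <= r) -> (mu A <= r%:E)%E.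
Proof.
move=> [z Az] mA Ar.
have lA : has_lbound A.
  by exists (z - r) => y Ay; rewrite lerBlDl -lerBlDr; exact: Ar.
have r0 : 0 <= r by rewrite -(subrr z); exact: Ar.
apply: (@le_trans _ _ (mu `[inf A, inf A + r])).
  apply: le_measure; rewrite ?inE// => x Ax /=; rewrite in_itv/= ge_inf//=.
  rewrite -lerBlDr; apply: lb_le_inf; first by exists z.
  by move=> y Ay; rewrite lerBlDr -lerBlDl; exact: Ar.
rewrite /= lebesgue_measure_itv/= lte_fin; case: ifPn => // _.
by rewrite -EFinB addrAC subrr add0r.
Qed.

Lemma le_lebesgue_measure_interval (C : set R) (x y : R) : is_interval C ->
  C x -> C y -> ((y - x)%:E <= mu C)%E.
Proof.
move=> iC Cx Cy; have [xy|yx] := ltP x y; last first.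
  by rewrite (@le_trans _ _ 0%E)// lee_fin subr_le0.
apply: (@le_trans _ _ (mu `[x, y])).
  by rewrite /= lebesgue_measure_itv/= lte_fin xy.
apply: le_measure; rewrite ?inE//; first exact: is_interval_measurable.
by move=> z /=; rewrite in_itv/=; exact: iC.
Qed.

(** The measure of an interval dominates the distance between any two of its points, while those of
    [A] and [B] are at most their diameters. It is therefore enough to compare distances between
    pairs of points. *)
Lemma brunn_minkowski_interval (A B C : set R) (a : R) : 0 < a < 1 ->
  A !=set0 -> B !=set0 -> measurable A -> measurable B -> is_interval C ->
  (forall x y, A x -> B y -> C (a * x + (1 - a) * y)) ->
  (a%:E * mu A + (1 - a)%:E * mu B <= mu C)%E.
Proof.
move=> /andP[a0 a1] A0 B0 mA mB iC ABC.
have b0 : 0 < 1 - a by rewrite subr_gt0.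
have [->|C_fin] := eqVneq (mu C) +oo%E; first exact: leey.
have C_real : mu C \is a fin_num by rewrite ge0_fin_numE// ltey.
rewrite -(fineK C_real); set c := fine (mu C).
have ABc x1 x2 y1 y2 : A x1 -> A x2 -> B y1 -> B y2 ->
    a * (x2 - x1) + (1 - a) * (y2 - y1) <= c.
  move=> Ax1 Ax2 By1 By2; rewrite -lee_fin /c fineK//.
  have := le_lebesgue_measure_interval iC (ABC _ _ Ax1 By1) (ABC _ _ Ax2 By2).
  by congr (_ <= _)%E; congr EFin; ring.
(* The two diameters are bounded in turn: with x1 and x2 fixed, y1 and y2 vary to bound [mu B]; then
   x1 and x2 vary, with [mu B] already in the inequality. *)
have muB x1 x2 : A x1 -> A x2 -> (mu B <= ((c - a * (x2 - x1)) / (1 - a))%:E)%E.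
  move=> Ax1 Ax2; apply: lebesgue_measure_diameter_le => // y1 y2 By1 By2.
  by rewrite ler_pdivlMr//; have := ABc _ _ _ _ Ax1 Ax2 By1 By2; lra.
have B_real : mu B \is a fin_num.
  have [x Ax] := A0; rewrite ge0_fin_numE//.
  by apply: le_lt_trans (muB _ _ Ax Ax) _; rewrite ltry.
have muA : (mu A <= ((c - (1 - a) * fine (mu B)) / a)%:E)%E.
  apply: lebesgue_measure_diameter_le => // x1 x2 Ax1 Ax2.
  have := muB _ _ Ax1 Ax2; rewrite -{1}(fineK B_real) lee_fin.
  by rewrite !ler_pdivlMr//; lra.
have A_real : mu A \is a fin_num.
  by rewrite ge0_fin_numE//; apply: le_lt_trans muA _; rewrite ltry.
rewrite -(fineK A_real) -(fineK B_real) -!EFinM -EFinD lee_fin.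
by move: muA; rewrite -{1}(fineK A_real) lee_fin ler_pdivlMr//; lra.
Qed.

End brunn_minkowski_interval.

(** * The Prekopa-Leindler inequality on the line *)

Section prekopa_leindler.
Context {R : realType}.
Local Notation RT := (measurableTypeR R).
Local Notation mu := (@lebesgue_measure R).
Implicit Types f g h : R -> R.

Let ge0_le_powR (a x y : R) : 0 < a -> 0 <= x -> x <= y -> x `^ a <= y `^ a.
Proof.
by move=> a0 x0 xy; rewrite ge0_ler_powR// ?nnegrE ?(ltW a0)// (le_trans x0).
Qed.

Let powR1D (a x : R) : 0 <= x -> x `^ a * x `^ (1 - a) = x.
Proof. by move=> x0; rewrite -powRD addrC subrK ?oner_eq0// powRr1. Qed.

(** Brunn-Minkowski at each height s, integrated over s. It needs nonempty superlevel sets of [f]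
    and [g] at the same heights, hence the common supremum 1. The arithmetic mean of the integrals,
    which dominates the geometric one, is then available. *)
Lemma prekopa_leindler_unit (a : R) f g h : 0 < a < 1 ->
  measurable_fun setT f -> measurable_fun setT g -> measurable_fun setT h ->
  (forall x, 0 <= f x <= 1) -> (forall x, 0 <= g x <= 1) ->
  (forall x, 0 <= h x) ->
  (forall s, is_interval [set x | s <= h x]) ->
  (forall s, s < 1 -> exists x, s <= f x) ->
  (forall s, s < 1 -> exists x, s <= g x) ->
  (forall x y, f x `^ a * g y `^ (1 - a) <= h (a * x + (1 - a) * y)) ->
  (a%:E * \int[mu]_x (f x)%:E + (1 - a)%:E * \int[mu]_x (g x)%:E <=
   \int[mu]_x (h x)%:E)%E.
Proof.
move=> a01 mf mg mh f01 g01 h0 ih supf supg fgh; have /andP[a0 a1] := a01.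
have b0 : 0 < 1 - a by rewrite subr_gt0.
have f0 x : 0 <= f x by case/andP: (f01 x).
have g0 x : 0 <= g x by case/andP: (g01 x).
have mlevel (k : R -> R) D : measurable_fun setT k ->
    measurable_fun D (fun s : RT => mu [set x | s <= k x]).
  move=> mk; apply: measurable_funTS.
  exact: (measurable_measure_superlevel mu mk).
have cake (k : R -> R) : measurable_fun setT k -> (forall x, 0 <= k x <= 1) ->
    (\int[mu]_x (k x)%:E =
     \int[mu]_(s in `]0%R, 1%R[) mu [set x | (s <= k x)%R])%E.
  move=> mk k01; rewrite -(layer_cake mu mk); last first.
    by move=> x; case/andP: (k01 x).
  apply: eq_integral => x _; rewrite min_l//.
  by case/andP: (k01 x).
rewrite (cake f)// (cake g)//.
apply: (@le_trans _ _ (\int[mu]_x (Num.min (h x) 1)%:E)%E); last first.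
  apply: ge0_le_integral => //.
  - by move=> x _; rewrite lee_fin le_min h0 ler01.
  - by apply/measurable_EFinP; exact: measurable_minr.
  - by apply/measurable_EFinP.
  - by move=> x _; rewrite lee_fin ge_min lexx.
rewrite (layer_cake mu mh)//.
rewrite -!ge0_integralZl//; [|exact: mlevel|by rewrite lee_fin ltW
  |exact: mlevel|by rewrite lee_fin ltW].
rewrite -ge0_integralD//; last 4 first.
- by move=> s _; rewrite mule_ge0// lee_fin ltW.
- by apply: measurable_funeM; exact: mlevel.
- by move=> s _; rewrite mule_ge0// lee_fin ltW.
- by apply: measurable_funeM; exact: mlevel.
apply: ge0_le_integral => //.
- by move=> s _; rewrite adde_ge0// mule_ge0// lee_fin ltW.
- by apply: emeasurable_funD; apply: measurable_funeM; exact: mlevel.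
- exact: mlevel.
move=> s /=; rewrite in_itv/= => /andP[s0 s1].
apply: brunn_minkowski_interval => //.
- exact: supf.
- exact: supg.
- exact: measurable_superlevel.
- exact: measurable_superlevel.
(* Writing s as [s^a * s^(1-a)] shows that the level sets of [f] and [g] at height s combine into
   that of [h] at the same height. *)
move=> x y /= sf sg; apply: le_trans (fgh x y).
rewrite -(powR1D a (ltW s0)); apply: ler_pM; rewrite ?powR_ge0//;
  by apply: ge0_le_powR => //; exact: ltW.
Qed.

(* Dividing f and g by their suprema reduces to prekopa_leindler_unit. *)
Lemma prekopa_leindler_bounded (a : R) f g h (F G H : R) : 0 < a < 1 ->
  measurable_fun setT f -> measurable_fun setT g -> measurable_fun setT h ->
  (forall x, 0 <= f x) -> (forall x, 0 <= g x) -> (forall x, 0 <= h x) ->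
  has_ubound (range f) -> has_ubound (range g) ->
  (forall s, is_interval [set x | s <= h x]) ->
  (forall x y, f x `^ a * g y `^ (1 - a) <= h (a * x + (1 - a) * y)) ->
  (\int[mu]_x (f x)%:E)%E = F%:E -> (\int[mu]_x (g x)%:E)%E = G%:E ->
  (\int[mu]_x (h x)%:E)%E = H%:E -> F `^ a * G `^ (1 - a) <= H.
Proof.
move=> a01 mf mg mh f0 g0 h0 bf bg ih fgh intf intg inth; have /andP[a0 a1] := a01.
have b0 : 0 < 1 - a by rewrite subr_gt0.
have F0 : 0 <= F by rewrite -lee_fin -intf integral_ge0// => x _; rewrite lee_fin.
have G0 : 0 <= G by rewrite -lee_fin -intg integral_ge0// => x _; rewrite lee_fin.
have H0 : 0 <= H by rewrite -lee_fin -inth integral_ge0// => x _; rewrite lee_fin.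
have zero (k : R -> R) : has_ubound (range k) -> (forall x, 0 <= k x) ->
    sup (range k) <= 0 -> (\int[mu]_x (k x)%:E = 0)%E.
  move=> bk k0 sk; apply: integral0_eq => x _; congr EFin; apply/eqP.
  rewrite eq_le k0 andbT (le_trans _ sk)//; apply: ub_le_sup => //; by exists x.
set S := sup (range f); set T := sup (range g).
have [S0|S0] := leP S 0.
  have -> : F = 0 by apply: EFin_inj; rewrite -intf zero.
  by rewrite powR0 ?gt_eqF// mul0r.
have [T0|T0] := leP T 0.
  have -> : G = 0 by apply: EFin_inj; rewrite -intg zero.
  by rewrite [X in _ * X]powR0 ?gt_eqF// mulr0.
pose C := S `^ a * T `^ (1 - a).
have C0 : 0 < C by rewrite mulr_gt0// powR_gt0.
have intZ (k : R -> R) (c K : R) : measurable_fun setT k ->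
    (forall x, 0 <= k x) -> 0 < c -> (\int[mu]_x (k x)%:E = K%:E)%E ->
    (\int[mu]_x (k x / c)%:E = (K / c)%:E)%E.
  move=> mk k0 c0 intk; under eq_integral do rewrite EFinM.
  rewrite ge0_integralZr//; last 3 first.
  - exact/measurable_EFinP.
  - by move=> x _; rewrite lee_fin.
  - by rewrite lee_fin invr_ge0 ltW.
  by rewrite intk.
have mZ (k : R -> R) (c : R) : measurable_fun setT k ->
    measurable_fun setT (fun x : RT => k x / c).
  by move=> mk; apply: measurable_funM.
have supZ (k : R -> R) s : has_ubound (range k) -> 0 < sup (range k) ->
    s < 1 -> exists x, s <= k x / sup (range k).
  move=> bk k0 s1.
  have hk : has_sup (range k) by split => //; exists (k 0), 0.
  have e0 : 0 < (1 - s) * sup (range k) by rewrite mulr_gt0// subr_gt0.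
  have [_ [x _ <-] sx] := sup_adherent e0 hk.
  by exists x; rewrite ler_pdivlMr//; apply: ltW; apply: le_lt_trans sx; lra.
have le1 (k : R -> R) x : has_ubound (range k) -> (forall x, 0 <= k x) ->
    0 < sup (range k) -> 0 <= k x / sup (range k) <= 1.
  move=> bk k0 sk; rewrite divr_ge0 ?(ltW sk)//= ler_pdivrMr// mul1r.
  by apply: ub_le_sup => //; exists x.
have := @prekopa_leindler_unit a (fun x => f x / S) (fun x => g x / T)
  (fun x => h x / C) a01 (mZ _ _ mf) (mZ _ _ mg) (mZ _ _ mh)
  (fun x => le1 _ x bf f0 S0) (fun x => le1 _ x bg g0 T0).
rewrite (intZ f S F)// (intZ g T G)// (intZ h C H)// => key.
have {key} : a * (F / S) + (1 - a) * (G / T) <= H / C.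
  rewrite -lee_fin EFinD !EFinM; apply: key => //.
  - by move=> x; rewrite divr_ge0// ltW.
  - move=> s x y /=; rewrite !ler_pdivlMr// => sx sy z xyz.
    by rewrite /= ler_pdivlMr//; exact: (ih (s * C) x y).
  - by move=> s; exact: supZ.
  - by move=> s; exact: supZ.
  move=> x y; rewrite ler_pdivlMr// /C mulrACA.
  rewrite -!powRM ?divr_ge0 ?(ltW S0) ?(ltW T0)//.
  by rewrite !divfK ?gt_eqF.
move=> key.
have FS0 : 0 <= F / S by rewrite divr_ge0// ltW.
have GT0 : 0 <= G / T by rewrite divr_ge0// ltW.
have := le_trans (weighted_AMGM FS0 GT0 a01) key.
rewrite ler_pdivlMr// /C mulrACA -!powRM ?divr_ge0 ?(ltW S0) ?(ltW T0)//.
by rewrite !divfK ?gt_eqF.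
Qed.

(** Monotone convergence of the truncations at integer heights; it reduces the general inequality to
    bounded functions. *)
Lemma integral_truncation_ge f (F r : R) : measurable_fun setT f ->
  (forall x, 0 <= f x) -> (\int[mu]_x (f x)%:E)%E = F%:E -> r < F ->
  exists2 M : R, 0 <= M & exists2 K : R, r <= K <= F &
    (\int[mu]_x (Num.min (f x) M)%:E)%E = K%:E.
Proof.
move=> mf f0 intf rF.
have mmin (M : R) : measurable_fun setT (fun x : RT => (Num.min (f x) M)%:E).
  by apply/measurable_EFinP; exact: measurable_minr.
have cvg : (\int[mu]_x (Num.min (f x) n%:R)%:E)%E @[n --> \oo] --> (F%:E)%E.
  rewrite -intf.
  rewrite [X in _ --> X](_ : _ =
      \int[mu]_x limn (fun n => (Num.min (f x) n%:R)%:E))%E.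
    apply: cvg_monotone_convergence => //.
    - by move=> n x _; rewrite lee_fin le_min f0 ler0n.
    - move=> x _ n p np; rewrite lee_fin le_min ge_min lexx/= ge_min.
      by rewrite ler_nat np orbT.
  apply: eq_integral => x _; apply/esym/cvg_lim => //.
  apply: cvg_near_cst; near=> n; congr EFin; apply: min_l.
  by near: n; exact: nbhs_infty_ger.
have [n rn] : exists n, (r%:E < \int[mu]_x (Num.min (f x) n%:R)%:E)%E.
  apply: contrapT => /forallNP rn; move: rF; apply/negP; rewrite -leNgt -lee_fin.
  by apply: (cvge_le _ cvg); apply: nearW => n; rewrite leNgt; exact/negP/rn.
have leF : (\int[mu]_x (Num.min (f x) n%:R)%:E <= F%:E)%E.
  rewrite -intf; apply: ge0_le_integral => //.
  - by move=> x _; rewrite lee_fin le_min f0 ler0n.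
  - exact/measurable_EFinP.
  - by move=> x _; rewrite lee_fin ge_min lexx.
have fin : (\int[mu]_x (Num.min (f x) n%:R)%:E)%E \is a fin_num.
  rewrite ge0_fin_numE; first by rewrite (le_lt_trans leF)// ltry.
  by apply: integral_ge0 => x _; rewrite lee_fin le_min f0 ler0n.
exists n%:R => //; exists (fine (\int[mu]_x (Num.min (f x) n%:R)%:E)%E).
  by rewrite -!lee_fin fineK// leF (ltW rn).
by rewrite fineK.
Unshelve. all: by end_near. Qed.

(** Truncating [f] and [g] while keeping [h] preserves the pointwise inequality. The truncations can
    be chosen to retain at least a fraction r of each integral, for any r < 1. *)
Theorem prekopa_leindler (a : R) f g h (F G H : R) : 0 < a < 1 ->
  measurable_fun setT f -> measurable_fun setT g -> measurable_fun setT h ->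
  (forall x, 0 <= f x) -> (forall x, 0 <= g x) -> (forall x, 0 <= h x) ->
  (forall s, is_interval [set x | s <= h x]) ->
  (forall x y, f x `^ a * g y `^ (1 - a) <= h (a * x + (1 - a) * y)) ->
  (\int[mu]_x (f x)%:E)%E = F%:E -> (\int[mu]_x (g x)%:E)%E = G%:E ->
  (\int[mu]_x (h x)%:E)%E = H%:E -> F `^ a * G `^ (1 - a) <= H.
Proof.
move=> a01 mf mg mh f0 g0 h0 ih fgh intf intg inth; have /andP[a0 a1] := a01.
have b0 : 0 < 1 - a by rewrite subr_gt0.
have F0 : 0 <= F by rewrite -lee_fin -intf integral_ge0// => x _; rewrite lee_fin.
have G0 : 0 <= G by rewrite -lee_fin -intg integral_ge0// => x _; rewrite lee_fin.
have H0 : 0 <= H by rewrite -lee_fin -inth integral_ge0// => x _; rewrite lee_fin.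
have [->|Fn0] := eqVneq F 0; first by rewrite powR0 ?gt_eqF// mul0r.
have [->|Gn0] := eqVneq G 0; first by rewrite [X in _ * X]powR0 ?gt_eqF// mulr0.
have Fp : 0 < F by rewrite lt_def Fn0.
have Gp : 0 < G by rewrite lt_def Gn0.
have FG0 : 0 < F `^ a * G `^ (1 - a) by rewrite mulr_gt0// powR_gt0.
suff key r : 0 < r < 1 -> r * (F `^ a * G `^ (1 - a)) <= H.
  rewrite leNgt; apply/negP => HFG.
  pose q := H / (F `^ a * G `^ (1 - a)).
  have q1 : q < 1 by rewrite ltr_pdivrMr// mul1r.
  have q0 : 0 <= q by rewrite divr_ge0// ltW.
  (* The midpoint of [q] and 1 is a fraction below 1 that exceeds the ratio [q]. *)
  have := key ((q + 1) / 2); rewrite -ler_pdivlMr// -/q.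
  have h1 : 0 < (q + 1) / 2 < 1 by apply/andP; split; lra.
  by move=> /(_ h1); lra.
move=> /andP[r0 r1].
have rF : r * F < F by rewrite gtr_pMl.
have rG : r * G < G by rewrite gtr_pMl.
have [M M0 [K /andP[rK KF] intK]] := integral_truncation_ge mf f0 intf rF.
have [N N0 [L /andP[rL LG] intL]] := integral_truncation_ge mg g0 intg rG.
apply: (@le_trans _ _ (K `^ a * L `^ (1 - a))).
  rewrite -{1}(powR1D a (ltW r0)) mulrACA -!powRM ?(ltW r0)//.
  by apply: ler_pM; rewrite ?powR_ge0//; apply: ge0_le_powR => //;
    rewrite mulr_ge0// ltW.
apply: (@prekopa_leindler_bounded a (fun x => Num.min (f x) M)
  (fun x => Num.min (g x) N) h) => //.
- exact: measurable_minr.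
- exact: measurable_minr.
- by move=> x; rewrite le_min f0.
- by move=> x; rewrite le_min g0.
- by exists M => _ [x _ <-]; rewrite ge_min lexx orbT.
- by exists N => _ [x _ <-]; rewrite ge_min lexx orbT.
- move=> x y; apply: le_trans (fgh x y); apply: ler_pM; rewrite ?powR_ge0//;
  by apply: ge0_le_powR => //; rewrite ?le_min ?f0 ?g0// ge_min lexx.
Qed.

End prekopa_leindler.

(** * The Laplace kernel as a mixture of Gaussians *)

Section gauss_cdf.
Context {R : realType}.
Local Notation mu := (@lebesgue_measure R).

Definition gauss_primitive (x : R) : R :=
  (\int[mu]_(t in `]-oo, x]) gauss_fun t)%R.

Lemma is_derive_gauss_primitive (x : R) :
  is_derive x 1 gauss_primitive (gauss_fun x).
Proof.
have [] := @continuous_FTC1 R gauss_fun -oo%O x (x + 1) _ _ _ _.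
- by rewrite ltrDl.
- by apply: integrableS (@integrableT_gauss R).
- by rewrite ltNyr.
- exact: continuous_gauss_fun.
move=> dG GE; apply: (@DeriveDef _ _ _ _ _ gauss_primitive); first exact: dG.
by rewrite -derive1E; exact: GE.
Qed.

Let sqrt_pi_gt0 : 0 < Num.sqrt pi :> R.
Proof. by rewrite sqrtr_gt0 pi_gt0. Qed.

(** With variance 1/2 the normal density is [gauss_fun] divided by [sqrt pi], so the limits of
    [gauss_primitive] can be read off those of a distribution function, that of the identity under
    this law. *)
Let sigma : R := Num.sqrt 2^-1.

Let sigma_neq0 : sigma != 0.
Proof. by rewrite gt_eqF// sqrtr_gt0. Qed.

Let normal_pdf_sigma (x : R) :
  normal_pdf 0 sigma x = (Num.sqrt pi)^-1 * gauss_fun x.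
Proof.
rewrite normal_pdfE// /normal_peak /normal_fun subr0 sqr_sqrtr ?invr_ge0//.
by rewrite -mulrnAl -mulr_natr mulVf ?mul1r// divr1.
Qed.

Let idRT : measurableTypeR R -> R := idfun.

#[local] HB.instance Definition _ :=
  @isMeasurableFun.Build _ _ _ _ idRT (@measurable_id _ _ setT).

Let X : {RV (normal_prob 0 sigma) >-> R} := idRT.

Let cdf_gauss_primitive (x : R) :
  cdf X x = ((Num.sqrt pi)^-1 * gauss_primitive x)%:E.
Proof.
rewrite [LHS](_ : _ = normal_prob 0 sigma `]-oo, x])// /normal_prob.
under eq_integral do rewrite normal_pdf_sigma EFinM.
have igauss : mu.-integrable `]-oo, x] (EFin \o @gauss_fun R).
  by apply: integrableS (@integrableT_gauss R).
rewrite integralZl// EFinM /gauss_primitive /Rintegral fineK//.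
exact: integrable_fin_num.
Qed.

Let cvg_of_cdf (F : set_system R) (l : R) : Filter F ->
  cdf X x @[x --> F] --> l%:E -> gauss_primitive x @[x --> F] --> Num.sqrt pi * l.
Proof.
move=> FF; rewrite (_ : cdf X =
  fun x => ((Num.sqrt pi)^-1 * gauss_primitive x)%:E); last first.
  by apply/funext => x; exact: cdf_gauss_primitive.
move=> /fine_cvg/= cl.
rewrite (_ : gauss_primitive =
  fun x => Num.sqrt pi * ((Num.sqrt pi)^-1 * gauss_primitive x)).
  by apply: cvgMl_tmp; exact: cl.
by apply/funext => x; rewrite mulVKf// gt_eqF.
Qed.

Lemma cvgy_gauss_primitive : gauss_primitive x @[x --> +oo] --> Num.sqrt pi.
Proof. by rewrite -[Num.sqrt _]mulr1; apply: cvg_of_cdf; exact: cvg_cdfy1. Qed.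

Lemma cvgNy_gauss_primitive : gauss_primitive x @[x --> -oo] --> (0 : R).
Proof.
by rewrite -[0](mulr0 (Num.sqrt pi)); apply: cvg_of_cdf; exact: cvg_cdfNy0.
Qed.

Lemma gauss_primitive0 : gauss_primitive 0 = Num.sqrt pi / 2.
Proof.
rewrite /gauss_primitive /Rintegral.
rewrite (_ : (\int[mu]_(x in _) _)%E =
  (\int[mu]_(x in `[0%R, +oo[) (gauss_fun x)%:E)%E).
  by rewrite integral0y_gauss.
rewrite ge0_integration_by_substitution0.
- by apply: eq_integral => x _; rewrite /gauss_fun sqrrN.
- by apply/measurable_EFinP; exact: measurable_gauss_fun.
- by move=> x; rewrite lee_fin gauss_fun_ge0.
Qed.

End gauss_cdf.

Section FTC_real_line.
Context {R : realType}.
Local Notation mu := (@lebesgue_measure R).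

(** The left half-line is reflected, with primitive [- F (- x)], so that the one-sided theorem at
    +oo serves twice. *)
Lemma ge0_continuous_FTC2T (f F : R -> R) (l0 l1 : R) :
  (forall x, 0 <= f x) -> continuous f ->
  (forall x : R, is_derive x 1 F (f x)) ->
  F x @[x --> -oo] --> l0 -> F x @[x --> +oo] --> l1 ->
  (\int[mu]_x (f x)%:E = (l1 - l0)%:E)%E.
Proof.
move=> f0 cf dF Fl0 Fl1.
have mf : measurable_fun setT f by exact: continuous_measurable_fun.
have cF : continuous F.
  by move=> x; apply/differentiable_continuous/derivable1_diffP; case: (dF x).
have cf' : continuous (f \o -%R).
  by move=> x; apply: continuous_comp; [exact: opp_continuous|exact: cf].
have I1 : (\int[mu]_(x in `[0%R, +oo[) (f x)%:E = l1%:E - (F 0)%:E)%E.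
  apply: ge0_continuous_FTC2y => //.
  - exact: continuous_subspaceT.
  - by apply: cvg_at_right_filter; exact: cF.
  - by move=> x _; rewrite derive1E; case: (dF x).
have dFN (x : R) : is_derive x 1 (fun x => - F (- x)) (f (- x)).
  have -> : f (- x) = - (f (- x) * -1) by rewrite mulrN1 opprK.
  by apply: is_deriveN; apply: (@is_derive1_comp _ F -%R).
have I2 : (\int[mu]_(x in `[0%R, +oo[) (f (- x))%:E =
    (- l0)%:E - (- F (- 0))%:E)%E.
  apply: (@ge0_continuous_FTC2y R (f \o -%R) (fun x => - F (- x))) => //.
  - by move=> x _; exact: f0.
  - exact: continuous_subspaceT.
  - by apply: cvgN; move/cvgNy_compNP: Fl0.
  - apply: cvg_at_right_filter.
    by have [/derivable1_diffP/differentiable_continuous] := dFN 0.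
  - by move=> x _; rewrite derive1E; case: (dFN x).
have -> : (\int[mu]_x (f x)%:E = \int[mu]_(x in `]-oo, 0%R]) (f x)%:E +
    \int[mu]_(x in `[0%R, +oo[) (f x)%:E)%E.
  have RE : [set: measurableTypeR R] = `]-oo, 0%R] `|` `]0%R, +oo[.
    apply/seteqP; split => // x _; rewrite /= !in_itv/= andbT.
    by case: (leP x 0) => _; [left|right].
  rewrite {1}RE ge0_integral_setU//; last 3 first.
  - by rewrite -RE; exact/measurable_EFinP.
  - by move=> x _; rewrite lee_fin.
  - rewrite disj_set2E; apply/eqP; rewrite -subset0 => x /= [].
    by rewrite !in_itv/= andbT leNgt => /negP.
  congr (_ + _)%E; rewrite integral_itv_obnd_cbnd//.
  exact/measurable_EFinP/measurable_funTS.
rewrite I1 -{1}oppr0 ge0_integration_by_substitutionNy//; last first.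
  exact: continuous_subspaceT.
rewrite /= I2 oppr0 -!EFinB -EFinD; congr EFin; ring.
Qed.

End FTC_real_line.

Section laplace_gaussian_mixture.
Context {R : realType}.
Local Notation mu := (@lebesgue_measure R).

(* The primitive is the one known from the inverse Gaussian distribution: with
   w = e^r - z e^(-r) and w' = e^r + z e^(-r), each of w, w' is the derivative
   of the other and gauss_fun w' = e^(-4z) gauss_fun w. *)
Let wm (z r : R) := expR r - expR (- r) * z.
Let wp (z r : R) := expR r + expR (- r) * z.
Let F (z r : R) := expR (- 2 * z) / 2 *
  (gauss_primitive (wm z r) + expR (4 * z) * gauss_primitive (wp z r)).
Let f (z r : R) := expR (r - expR r ^+ 2 - (expR (- r) * z) ^+ 2).

Let is_derive_wm (z r : R) : is_derive r 1 (wm z) (wp z r).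
Proof.
rewrite /wm /wp.
have d1 : is_derive r 1 (fun r => expR (- r)) (expR (- r) * -1).
  exact: (@is_derive1_comp _ expR -%R).
have d2 : is_derive r 1 (fun r => expR (- r) * z) (z * (expR (- r) * -1)).
  rewrite (_ : (fun r => _) = z \*: (fun r => expR (- r))).
    exact: is_deriveZ.
  by apply/funext => x /=; rewrite mulrC.
by apply: is_derive_eq; rewrite mulrN1 mulrN opprK mulrC.
Qed.

Let is_derive_wp (z r : R) : is_derive r 1 (wp z) (wm z r).
Proof.
have := is_derive_wm (- z) r; rewrite /wm /wp mulrN.
by under eq_fun do rewrite mulrN opprK.
Qed.

Let is_derive_F (z r : R) : is_derive r 1 (F z) (f z r).
Proof.
have dm : is_derive r 1 (fun r => gauss_primitive (wm z r))
    (gauss_fun (wm z r) * wp z r).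
  exact: (@is_derive1_comp _ gauss_primitive (wm z) _ _ _
    (is_derive_gauss_primitive _) (is_derive_wm z r)).
have dp : is_derive r 1 (fun r => gauss_primitive (wp z r))
    (gauss_fun (wp z r) * wm z r).
  exact: (@is_derive1_comp _ gauss_primitive (wp z) _ _ _
    (is_derive_gauss_primitive _) (is_derive_wp z r)).
have ee : expR r * expR (- r) = 1 by rewrite -expRD subrr expR0.
have gp : gauss_fun (wp z r) = expR (- 4 * z) * gauss_fun (wm z r).
  rewrite /gauss_fun -expRD; congr expR; rewrite /wp /wm.
  rewrite sqrrD sqrrB mulrA ee mul1r; ring.
have fE : f z r = expR (- 2 * z) * gauss_fun (wm z r) * expR r.
  rewrite /f /gauss_fun -!expRD; congr expR.
  rewrite /wm sqrrB mulrA ee mul1r; ring.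
have ez : expR (4 * z) * expR (- 4 * z) = 1 :> R.
  by rewrite -expRD mulNr subrr expR0.
apply: is_derive_eq.
rewrite fE gp -![_ *: _]/(_ * _) !mulrA ez mul1r /wp /wm.
by field.
Qed.

Let cvgy_of_ge (u : R -> R) (c b : R) : 0 < b ->
  (forall r, 0 <= r -> b * r - c <= u r) -> u r @[r --> +oo] --> +oo.
Proof.
move=> b0 cu; apply/cvgryPge => A; near=> r.
apply: (@le_trans _ _ (b * r - c)); last first.
  by apply: cu; near: r; exact: nbhs_pinfty_ge.
by rewrite lerBrDr mulrC -ler_pdivrMr.
Unshelve. all: by end_near. Qed.

Let cvgy_wm (z : R) : 0 <= z -> wm z r @[r --> +oo] --> +oo.
Proof.
move=> z0; apply: (@cvgy_of_ge _ z 1) => // r r0.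
rewrite mul1r lerB// ?(le_trans _ (expR_ge1Dx r)) ?lerDr//.
by rewrite ler_piMl// -expR0 ler_expR oppr_le0.
Qed.

Let cvgy_wp (z : R) : 0 <= z -> wp z r @[r --> +oo] --> +oo.
Proof.
move=> z0; apply: (@cvgy_of_ge _ 0 1) => // r r0.
rewrite mul1r subr0 (le_trans _ (_ : expR r <= _))//.
  by rewrite (le_trans _ (expR_ge1Dx r)) ?lerDr.
by rewrite lerDl mulr_ge0// expR_ge0.
Qed.

Let cvgNy_wp (z : R) : 0 < z -> wp z r @[r --> -oo] --> +oo.
Proof.
move=> z0; apply/cvgNy_compNP; apply: (@cvgy_of_ge _ 0 z) => // r r0.
rewrite subr0 /= /wp opprK (le_trans _ (_ : expR r * z <= _))//.
  by rewrite mulrC ler_pM2r// (le_trans _ (expR_ge1Dx r)) ?lerDr.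
by rewrite lerDr expR_ge0.
Qed.

Let cvgNy_wm (z : R) : 0 < z -> wm z r @[r --> -oo] --> -oo.
Proof.
move=> z0; apply/cvgNy_compNP.
apply/cvgNry; apply: (@cvgy_of_ge _ 1 z) => // r r0.
rewrite /= /wm opprK opprB lerB//.
  by rewrite mulrC ler_pM2r// (le_trans _ (expR_ge1Dx r)) ?lerDr.
by rewrite -expR0 ler_expR oppr_le0.
Qed.

Lemma integral_laplace_mixture (y : R) :
  (\int[mu]_r (expR (r - expR r ^+ 2 - (expR (- r) * y) ^+ 2))%:E =
   (Num.sqrt pi / 2 * expR (- 2 * `|y|))%:E)%E.
Proof.
have cf z : continuous (f z).
  have cX : continuous (fun x : R => x ^+ 2) by move=> ?; exact: exprn_continuous.
  have cN : continuous (fun r : R => expR (- r)).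
    move=> r; apply: (@continuous_comp _ _ _ -%R expR); first exact: opp_continuous.
    exact: continuous_expR.
  move=> r; apply: (@continuous_comp _ _ _
    (fun r => r - expR r ^+ 2 - (expR (- r) * z) ^+ 2) expR); last first.
    exact: continuous_expR.
  apply: cvgB; last first.
    apply: (@continuous_comp _ _ _ (fun r => expR (- r) * z) (fun x => x ^+ 2)).
      by apply: cvgMr_tmp; exact: cN.
    exact: cX.
  apply: cvgB; first exact: cvg_id.
  apply: (@continuous_comp _ _ _ expR (fun x => x ^+ 2)); first exact: continuous_expR.
  exact: cX.
transitivity (\int[mu]_r (f `|y| r)%:E)%E.
  by apply: eq_integral => r _; rewrite /f !exprMn real_normK ?num_real.
have limF (G : set_system R) (l1 l2 : R) : Filter G ->
    gauss_primitive (wm `|y| r) @[r --> G] --> l1 ->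
    gauss_primitive (wp `|y| r) @[r --> G] --> l2 ->
    F `|y| r @[r --> G] --> expR (- 2 * `|y|) / 2 * (l1 + expR (4 * `|y|) * l2).
  move=> FG c1 c2; apply: cvgMl_tmp; apply: cvgD => //; exact: cvgMl_tmp.
have limy : F `|y| r @[r --> +oo] -->
    expR (- 2 * `|y|) / 2 * (Num.sqrt pi + expR (4 * `|y|) * Num.sqrt pi).
  apply: limF.
  - exact: (@cvg_comp _ _ _ (wm `|y|) gauss_primitive _ _ _
      (cvgy_wm (normr_ge0 y)) cvgy_gauss_primitive).
  - exact: (@cvg_comp _ _ _ (wp `|y|) gauss_primitive _ _ _
      (cvgy_wp (normr_ge0 y)) cvgy_gauss_primitive).
(* The behaviour at -oo is discontinuous in y: for y = 0 both [wm] and [wp] tend to 0, the midpoint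
   of the Gaussian, whereas otherwise they tend to -oo and +oo. The difference of limits is given by
   one formula all the same. *)
have [y0|y0] := eqVneq y 0.
  have w0 : expR r @[r --> -oo] --> (0 : R) by apply/cvgNy_compNP; exact: cvgr_expR.
  have cG : {for 0 : R, continuous (@gauss_primitive R)}.
    have dG := is_derive_gauss_primitive (0 : R).
    by have [/derivable1_diffP/differentiable_continuous] := dG.
  have limNy : F `|y| r @[r --> -oo] --> expR (- 2 * `|y|) / 2 *
      (Num.sqrt pi / 2 + expR (4 * `|y|) * (Num.sqrt pi / 2)).
    apply: limF; rewrite -gauss_primitive0 y0 normr0.
    - under eq_fun do rewrite /wm mulr0 subr0.
      exact: (@cvg_comp _ _ _ expR gauss_primitive _ _ _ w0 cG).
    - under eq_fun do rewrite /wp mulr0 addr0.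
      exact: (@cvg_comp _ _ _ expR gauss_primitive _ _ _ w0 cG).
  rewrite (ge0_continuous_FTC2T _ (cf _) (is_derive_F _) limNy limy).
    by rewrite y0 normr0 !mulr0 expR0; congr EFin; lra.
  by move=> r; exact: expR_ge0.
have yp : 0 < `|y| by rewrite normr_gt0.
have limNy : F `|y| r @[r --> -oo] -->
    expR (- 2 * `|y|) / 2 * (0 + expR (4 * `|y|) * Num.sqrt pi).
  apply: limF.
  - exact: (@cvg_comp _ _ _ (wm `|y|) gauss_primitive _ _ _
      (cvgNy_wm yp) cvgNy_gauss_primitive).
  - exact: (@cvg_comp _ _ _ (wp `|y|) gauss_primitive _ _ _
      (cvgNy_wp yp) cvgy_gauss_primitive).
rewrite (ge0_continuous_FTC2T _ (cf _) (is_derive_F _) limNy limy).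
  by congr EFin; lra.
by move=> r; exact: expR_ge0.
Qed.

End laplace_gaussian_mixture.

(** * From Gaussian to exponential weights *)

Section log_concave_marginal.
Context {R : realType} {n : nat}.
Local Notation mu := (@lebesgue_measure R).

Lemma log_concave_is_interval (h : R -> R) (s : R) : (forall x, 0 <= h x) ->
  (forall (x y a : R), 0 < a < 1 ->
     h x `^ a * h y `^ (1 - a) <= h (a * x + (1 - a) * y)) ->
  is_interval [set x | s <= h x].
Proof.
move=> h0 hlc; apply/is_intervalPlt => x y /= sx sy z /andP[xz zy].
have [s0|s0] := ltP s 0; first by rewrite (le_trans (ltW s0)).
have xy : 0 < y - x by rewrite subr_gt0 (lt_trans xz).
pose a := (y - z) / (y - x).
have a01 : 0 < a < 1.
  rewrite /a; apply/andP; split; first by rewrite divr_gt0// subr_gt0.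
  by rewrite ltr_pdivrMr// mul1r ltrD2l ltrN2.
have -> : z = a * x + (1 - a) * y.
  by rewrite /a; field; rewrite gt_eqF.
have /andP[a0 a1] := a01.
apply: le_trans (hlc _ _ _ a01).
rewrite -{1}(powRr1 s0) -{1}(subrKC a 1) powRD ?subrKC ?oner_eq0//.
have le_pow (p u : R) : 0 < p -> s <= u -> s `^ p <= u `^ p.
  by move=> p0 su; rewrite ge0_ler_powR ?nnegrE ?(ltW p0)// (le_trans s0).
by apply: ler_pM; rewrite ?powR_ge0//; apply: le_pow; rewrite ?subr_gt0.
Qed.

(** Prekopa-Leindler on the slices over s, t and their combination. The joint inequality with both
    parameters equal makes the last slice log-concave in r, so its superlevel sets are intervals. *)
Lemma log_concave_integral (Phi : 'rV[R]_n -> R -> R) (I : 'rV[R]_n -> R) :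
  (forall w r, 0 <= Phi w r) -> (forall w, measurable_fun setT (Phi w)) ->
  (forall s t x y (a : R), 0 < a < 1 -> Phi s x `^ a * Phi t y `^ (1 - a) <=
     Phi (a *: s + (1 - a) *: t) (a * x + (1 - a) * y)) ->
  (forall w, (\int[mu]_r (Phi w r)%:E = (I w)%:E)%E) ->
  log_concave I.
Proof.
move=> Phi0 mPhi lcPhi intPhi; split=> [w|s t a a01].
  by rewrite -lee_fin -intPhi integral_ge0// => r _; rewrite lee_fin.
apply: (@prekopa_leindler _ a (Phi s) (Phi t)
  (Phi (a *: s + (1 - a) *: t))) => //.
- move=> r; apply: log_concave_is_interval => // x y b b01.
  have := lcPhi (a *: s + (1 - a) *: t) (a *: s + (1 - a) *: t) x y b b01.
  by rewrite -scalerDl subrKC scale1r.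
- by move=> x y; exact: lcPhi.
Qed.

Lemma powR_expR_mean (x y a : R) :
  expR x `^ a * expR y `^ (1 - a) = expR (a * x + (1 - a) * y).
Proof. by rewrite -!expRM -expRD; congr expR; rewrite mulrC (mulrC y). Qed.

Lemma expR_mean_le (x y a : R) : 0 < a < 1 ->
  expR (a * x + (1 - a) * y) <= a * expR x + (1 - a) * expR y.
Proof. by move=> a01; rewrite -powR_expR_mean weighted_AMGM// expR_ge0. Qed.

End log_concave_marginal.

(** * Mixed weights and their integrability *)

Section mixed_integral.
Context {R : realType} {d n : nat} (V : 'M[R]_(d, n)).
Hypothesis VVT : V *m V^T = 1%:M.
Local Notation RT := (measurableTypeR R).
Local Notation mu := (@lebesgue_measure R).
Implicit Types (b : 'I_n -> bool) (w : 'rV[R]_n) (c : d.-tuple RT).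

(* The flag b i selects the Laplace weight (true) or the Gaussian weight
   (false) in coordinate i. *)
Definition cost (b : bool) (w x : R) : R :=
  if b then 2 * expR w * `|x| else (expR w * x) ^+ 2.

Definition potential b w c : R :=
  \sum_i cost (b i) (w ord0 i) ((row_of_tuple c *m V) ord0 i).

Definition mixed_integral b w : \bar R :=
  (\int[lebesgue_tuple d]_c (expR (- potential b w c))%:E)%E.

(** For the Gaussian weight this is [(expR w * |x| - 1)^2 >= 0]. A single exponential majorant then
    serves for all flags. *)
Lemma cost_ge (b : bool) (w x : R) : 2 * expR w * `|x| - 1 <= cost b w x.
Proof.
rewrite /cost; case: b; first by rewrite gerBl.
have := sqr_ge0 (expR w * `|x| - 1).
rewrite sqrrB exprMn real_normK ?num_real//.
by rewrite -exprMn; lra.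
Qed.

Lemma measurable_potential b w : measurable_fun setT (potential b w : _ -> RT).
Proof.
apply: measurable_sum => i; rewrite /cost; case: (b i).
  apply: measurable_funM => //; apply: measurableT_comp => //.
  exact: measurable_row_of_tuple_mulmx.
apply: measurable_funX; apply: measurable_funM => //.
exact: measurable_row_of_tuple_mulmx.
Qed.

(** [u] is recovered as [u *m V *m V^T], and the entries of [V] are at most 1 in absolute value
    since its rows are unit vectors. *)
Lemma l1_norm_coercive (u : 'rV[R]_d) :
  \sum_j `|u ord0 j| <= d%:R * \sum_i `|(u *m V) ord0 i|.
Proof.
have V1 j i : `|V j i| <= 1.
  rewrite -(@ler_pXn2r _ 2)// ?nnegrE// expr1n real_normK ?num_real//.
  have /matrixP/(_ j j) := VVT; rewrite !mxE eqxx mulr1n => VV1.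
  rewrite -[leRHS]VV1 (bigD1 i)//= mxE -expr2 lerDl sumr_ge0// => k _.
  by rewrite mxE -expr2 sqr_ge0.
rewrite mulr_natl -[X in _ *+ X]card_ord -sumr_const; apply: ler_sum => j _.
rewrite -{1}[u]mulmx1 -VVT mulmxA mxE; apply: le_trans (ler_norm_sum _ _ _) _.
apply: ler_sum => i _; rewrite normrM [V^T _ _]mxE.
by rewrite ler_piMr.
Qed.

Lemma potential_ge b w : exists2 r : R, 0 < r &
  forall c, r * (\sum_j `|row_of_tuple c ord0 j|) - n%:R <= potential b w c.
Proof.
pose m := expR (- \sum_i `|w ord0 i|).
have mw i : m <= expR (w ord0 i).
  rewrite ler_expR lerNl (le_trans (ler_norm _))// normrN.
  by rewrite (bigD1 i)//= lerDl sumr_ge0.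
have m0 : 0 < m by exact: expR_gt0.
(* Dividing by [d.+1] keeps the rate positive when [d = 0], where [m / 0] would be 0. *)
exists (m / d.+1%:R); first by rewrite divr_gt0// ltr0n.
move=> c; set u := row_of_tuple c.
apply: (@le_trans _ _
  (\sum_i (2 * expR (w ord0 i) * `|(u *m V) ord0 i| - 1))); last first.
  by apply: ler_sum => i _; exact: cost_ge.
rewrite sumrB sumr_const card_ord lerB//.
apply: (@le_trans _ _ (m * \sum_i `|(u *m V) ord0 i|)).
  rewrite -mulrA ler_pM2l// mulrC ler_pdivrMr ?ltr0n// mulrC.
  apply: le_trans (l1_norm_coercive u) _.
  by rewrite ler_wpM2r ?sumr_ge0// ler_nat.
rewrite mulr_sumr; apply: ler_sum => i _; rewrite ler_wpM2r//.
by apply: le_trans (mw i) _; rewrite ler_peMl ?expR_ge0// ler1n.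
Qed.

Lemma integral_exp_abs_lty (r : R) : 0 < r ->
  (\int[mu]_x (expR (- (r * `|x|)))%:E < +oo)%E.
Proof.
move=> r0.
rewrite ge0_symfun_integralT; last 3 first.
- by move=> x; exact: expR_ge0.
- move=> x; apply: (@continuous_comp _ _ _ (fun x : R => - (r * `|x|)) expR).
    by apply: cvgN; apply: cvgMl_tmp; exact: norm_continuous.
  exact: continuous_expR.
- by move=> x /=; rewrite normrN.
apply: lte_mul_pinfty => //.
rewrite (_ : [set x | _] = `[0%R, +oo[%classic); last first.
  by apply/seteqP; split=> x /=; rewrite in_itv/= andbT.
rewrite (_ : (\int[mu]_(x in _) _)%E = r^-1%:E); first exact: ltry.
transitivity (\int[mu]_(x in `[0%R, +oo[) (expR (- (r * x)))%:E)%E.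
  apply: eq_integral => x; rewrite inE/= in_itv/= andbT => x0.
  by rewrite ger0_norm.
have dE (x : R) : is_derive x 1 (fun x => - (r^-1 * expR (- (r * x))))
    (expR (- (r * x))).
  have d1 : is_derive x 1 (fun x => - (r * x)) (- (r * 1)).
    exact: is_deriveN.
  have d2 : is_derive x 1 (fun x => expR (- (r * x)))
      (expR (- (r * x)) * - (r * 1)).
    exact: (@is_derive1_comp _ expR (fun x => - (r * x))).
  apply: is_derive_eq; rewrite -[_ *: _]/(_ * _) mulr1 mulrN mulrN opprK mulrCA.
  by rewrite mulVf ?mulr1// gt_eqF.
have cont (g g' : R -> R) :
    (forall x : R, is_derive x 1 g (g' x)) -> continuous g.
  by move=> dg x; have [/derivable1_diffP/differentiable_continuous] := dg x.
rewrite (@ge0_continuous_FTC2y _ _ (fun x => - (r^-1 * expR (- (r * x)))) 0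
  (- (r^-1 * 0))).
- by rewrite !mulr0 oppr0 expR0 mulr1 -EFinB sub0r opprK.
- by move=> x _; exact: expR_ge0.
- apply: continuous_subspaceT => x.
  apply: (@continuous_comp _ _ _ (fun x : R => - (r * x)) expR); last first.
    exact: continuous_expR.
  by apply: cvgN; apply: cvgMl_tmp; exact: cvg_id.
- apply: cvgN; apply: cvgMl_tmp.
  apply: (@cvg_comp _ _ _ (fun x => r * x) (fun x => expR (- x)) _ +oo).
    by apply: (@gt0_cvgMry _ _ _ _ (fun x => x) r0); exact: cvg_id.
  exact: cvgr_expR.
- by move=> x _; case: (dE x).
- by apply: cvg_at_right_filter; exact: (cont _ _ dE).
- by move=> x _; rewrite derive1E; case: (dE x).
Qed.

Lemma measurable_exp_l1 (r : R) m : measurable_fun setT (fun c : m.-tuple RT =>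
    (expR (- (r * \sum_j `|row_of_tuple c ord0 j|)))%:E).
Proof.
apply/measurable_EFinP; apply: (measurableT_comp (@measurable_expR R)).
apply: measurable_funN; apply: measurable_funM => //.
apply: measurable_sum => j; apply: measurableT_comp => //.
exact: measurable_row_of_tuple.
Qed.

Lemma integral_exp_l1_lty (r : R) m : 0 < r ->
  (\int[lebesgue_tuple m]_c
     (expR (- (r * \sum_j `|row_of_tuple c ord0 j|)))%:E < +oo)%E.
Proof.
move=> r0.
have mE k := @measurable_exp_l1 r k.
elim: m => [|m IH].
  by rewrite integral_lebesgue_tuple0// ltry.
rewrite integral_lebesgue_tupleS//.
have l1_cons (x : R) (c : m.-tuple RT) :
    \sum_j `|row_of_tuple [tuple of x :: c] ord0 j| =
    `|x| + \sum_j `|row_of_tuple c ord0 j|.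
  rewrite big_ord_recl mxE tnth0; congr (_ + _).
  by apply: eq_bigr => j _; rewrite !mxE tnthS.
pose I1 := (\int[mu]_x (expR (- (r * `|x|)))%:E)%E.
have I1_ge0 : (0 <= I1)%E by apply: integral_ge0 => x _; rewrite lee_fin expR_ge0.
rewrite (_ : (\int[_]_c _)%E = (\int[lebesgue_tuple m]_c (I1 *
    (expR (- (r * \sum_j `|row_of_tuple c ord0 j|)))%:E))%E); last first.
  apply: eq_integral => c _; rewrite -ge0_integralZr//.
    by apply: eq_integral => x _; rewrite l1_cons mulrDr opprD expRD.
  apply/measurable_EFinP; apply: (measurableT_comp (@measurable_expR R)).
  by apply: measurable_funN; exact: measurable_funM.
rewrite ge0_integralZl//; last exact: mE.
apply: lte_mul_pinfty => //.
by rewrite ge0_fin_numE// integral_exp_abs_lty.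
Qed.

Lemma measurable_exp_potential b w :
  measurable_fun setT (fun c : d.-tuple RT => (expR (- potential b w c))%:E).
Proof.
apply/measurable_EFinP; apply: (measurableT_comp (@measurable_expR R)).
by apply: measurable_funN; exact: measurable_potential.
Qed.

(** As [fine] sends +oo to 0, log-concavity of [fine] of an integral speaks of the integral only
    once finiteness is known, here for every choice of flags. *)
Lemma mixed_integral_fin_num b w : mixed_integral b w \is a fin_num.
Proof.
rewrite ge0_fin_numE; last by apply: integral_ge0 => c _; rewrite lee_fin expR_ge0.
have [r r0 rp] := potential_ge b w.
have mE : measurable_fun setT (fun c : d.-tuple RT =>
    (expR (- (r * \sum_j `|row_of_tuple c ord0 j|)))%:E).
  exact: measurable_exp_l1.
apply: (@le_lt_trans _ _ (\int[lebesgue_tuple d]_c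
   ((expR n%:R)%:E * (expR (- (r * \sum_j `|row_of_tuple c ord0 j|)))%:E))%E).
  apply: ge0_le_integral => //.
  - exact: measurable_exp_potential.
  - exact: measurable_funeM.
  - move=> c _; rewrite -EFinM -expRD lee_fin ler_expR.
    by have := rp c; lra.
rewrite ge0_integralZl//; apply: lte_mul_pinfty => //.
exact: integral_exp_l1_lty.
Qed.

End mixed_integral.

Lemma powR_mean_mul (R : realType) (x u y v a : R) :
  0 <= x -> 0 <= u -> 0 <= y -> 0 <= v ->
  (x * u) `^ a * (y * v) `^ (1 - a) =
  (x `^ a * y `^ (1 - a)) * (u `^ a * v `^ (1 - a)).
Proof. by move=> x0 u0 y0 v0; rewrite !powRM// mulrACA. Qed.

(** Turns log-convexity of a determinant into log-concavity of a Gaussian integral, a constant over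
    its square root. *)
Lemma inv_sqrt_mean_le (R : realType) (N x y z a : R) :
  0 <= N -> 0 < x -> 0 < y -> 0 < z -> z <= x `^ a * y `^ (1 - a) ->
  (N / Num.sqrt x) `^ a * (N / Num.sqrt y) `^ (1 - a) <= N / Num.sqrt z.
Proof.
move=> N0 x0 y0 z0 zxy.
rewrite powR_mean_mul ?invr_ge0 ?sqrtr_ge0// -powRD; last first.
  by rewrite subrKC oner_eq0.
rewrite subrKC powRr1// ler_wpM2l//.
have sqrtV (u p : R) : 0 < u -> (Num.sqrt u)^-1 `^ p = (Num.sqrt (u `^ p))^-1.
  move=> u0; rewrite -!powR12_sqrt ?powR_ge0 ?(ltW u0)// -!powRN.
  by rewrite -!powRrM mulrC.
rewrite !sqrtV// -invfM -sqrtrM ?powR_ge0//.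
by rewrite lef_pV2 ?posrE ?sqrtr_gt0// ?mulr_gt0 ?powR_gt0// ler_wsqrtr.
Qed.

Section mixed_integral_log_concave.
Context {R : realType} {d n : nat} (V : 'M[R]_(d, n)).
Hypothesis VVT : V *m V^T = 1%:M.
Local Notation RT := (measurableTypeR R).
Local Notation mu := (@lebesgue_measure R).
Implicit Types (b : 'I_n -> bool) (w : 'rV[R]_n) (c : d.-tuple RT).

Let gram w := V *m diag_mx (map_mx expR (2 *: w)) *m V^T.

Let quadratic_form_gram w u :
  quadratic_form (gram w) u = \sum_i (expR (w ord0 i) * (u *m V) ord0 i) ^+ 2.
Proof.
rewrite /quadratic_form /gram !mulmxA -mulmxA -trmx_mul mxE.
apply: eq_bigr => i _; rewrite mul_mx_diag [X in X * _]mxE [(u *m V)^T _ _]mxE.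
rewrite [map_mx _ _ _ _]mxE [(2 *: w) _ _]mxE expRM_natl exprMn.
by rewrite mulrAC -expr2 mulrC.
Qed.

Let gram_sym w : (gram w)^T = gram w.
Proof. by rewrite /gram !trmx_mul trmxK tr_diag_mx mulmxA. Qed.

Let gram_posdef w : posdef (gram w).
Proof.
move=> u u0; rewrite quadratic_form_gram lt_def sumr_ge0 ?andbT; last first.
  by move=> i _; exact: sqr_ge0.
apply: contraNneq u0 => /eqP; rewrite psumr_eq0 => [|i _]; last exact: sqr_ge0.
move=> /allP uV0; rewrite -[u]mulmx1 -VVT mulmxA.
rewrite (_ : u *m V = 0) ?mul0mx//; apply/rowP => i; rewrite [RHS]mxE; apply/eqP.
by have := uV0 i (mem_index_enum i); rewrite sqrf_eq0 mulf_eq0 gt_eqF ?expR_gt0.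
Qed.

Lemma log_concave_gaussian :
  log_concave (fun w => fine (mixed_integral V (fun=> false) w)).
Proof.
have intE w : 0 < \det (gram w) /\
    fine (mixed_integral V (fun=> false) w) =
    Num.sqrt pi ^+ d / Num.sqrt (\det (gram w)).
  have [? intE] := integral_gauss_quadratic_form (gram_sym w) (@gram_posdef w).
  split=> //; rewrite -[RHS]/(fine _%:E) -intE; congr fine.
  by apply: eq_integral => c _; rewrite quadratic_form_gram.
have N0 : 0 <= Num.sqrt pi ^+ d :> R by rewrite exprn_ge0// sqrtr_ge0.
rewrite (_ : (fun w => _) =
  fun w => Num.sqrt pi ^+ d / Num.sqrt (\det (gram w))); last first.
  by apply/funext => w; exact: (intE w).2.
split=> [w|s t a a01]; first by rewrite divr_ge0// sqrtr_ge0.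
have [ds _] := intE s; have [dt _] := intE t.
have [dm _] := intE (a *: s + (1 - a) *: t).
have le_det := det_gram_log_convex V (2 *: s) (2 *: t) a01.
have {le_det} : \det (gram (a *: s + (1 - a) *: t)) <=
    \det (gram s) `^ a * \det (gram t) `^ (1 - a).
  by move: le_det; rewrite !scalerA !(mulrC _ 2) -!scalerA -scalerDr.
exact: inv_sqrt_mean_le.
Qed.

Definition set_true b i0 : 'I_n -> bool := fun i => (i == i0) || b i.

Let shift w (i0 : 'I_n) (r : R) : 'rV[R]_n := w - r *: delta_mx ord0 i0.

Let potential_shift b w i0 r c : ~~ b i0 ->
  potential V b (shift w i0 r) c =
  potential V (set_true b i0) w c -
  2 * expR (w ord0 i0) * `|(row_of_tuple c *m V) ord0 i0| +
  (expR (- r) * (expR (w ord0 i0) * (row_of_tuple c *m V) ord0 i0)) ^+ 2.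
Proof.
move=> bi0; rewrite /potential (bigD1 i0)//= [in RHS](bigD1 i0)//= /cost.
rewrite {1}/set_true eqxx (negbTE bi0).
rewrite /shift !mxE !eqxx mulr1 expRD mulrA [expR (- r) * _]mulrC.
rewrite [RHS]addrC; congr (_ + _); rewrite addrAC subrr add0r.
apply: eq_bigr => i ii0; rewrite /set_true (negbTE ii0)/= !mxE eqxx.
by rewrite (negbTE ii0) mulr0 subr0.
Qed.

Let weight (r : R) : R := expR (r - expR r ^+ 2).

(** The exponent [r - e^(2r)] is concave. *)
Let log_concave_weight (x y a : R) : 0 < a < 1 ->
  weight x `^ a * weight y `^ (1 - a) <= weight (a * x + (1 - a) * y).
Proof.
move=> a01; rewrite /weight powR_expR_mean ler_expR -!expRM_natl.
have := expR_mean_le (2 * x) (2 * y) a01.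
rewrite (_ : a * (2 * x) + (1 - a) * (2 * y) = 2 * (a * x + (1 - a) * y)).
  by lra.
by ring.
Qed.

Let measurable_potential_shift b w i0 : ~~ b i0 ->
  measurable_fun setT (fun p : RT * d.-tuple RT =>
    potential V b (shift w i0 p.1) p.2).
Proof.
move=> bi0; under eq_fun do rewrite potential_shift//.
have mV : measurable_fun setT (fun p : RT * d.-tuple RT =>
    (row_of_tuple p.2 *m V) ord0 i0).
  exact: (measurableT_comp (measurable_row_of_tuple_mulmx V i0) measurable_snd).
apply: measurable_funD; [apply: measurable_funB|apply: measurable_funX].
- exact: (measurableT_comp (measurable_potential V _ w) measurable_snd).
- by apply: measurable_funM => //; exact: measurableT_comp.
- apply: measurable_funM; last exact: measurable_funM.
  apply: (measurableT_comp (@measurable_expR R)); apply: measurable_funN.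
  exact: measurable_fst.
Qed.

Let measurable_weight : measurable_fun setT (weight : RT -> RT).
Proof.
apply: (measurableT_comp (@measurable_expR R)).
by apply: measurable_funB => //; apply: measurable_funX.
Qed.

Let measurable_mixed_integral_shift b w i0 : ~~ b i0 ->
  measurable_fun setT (fun r : RT => mixed_integral V b (shift w i0 r)).
Proof.
move=> bi0; apply: (measurable_fun_fubini_tonelli_F (m2 := lebesgue_tuple d)
    (fun p : RT * d.-tuple RT =>
      (expR (- potential V b (shift w i0 p.1) p.2))%:E)).
  apply/measurable_EFinP; apply: (measurableT_comp (@measurable_expR R)).
  by apply: measurable_funN; exact: measurable_potential_shift.
by move=> p; rewrite lee_fin expR_ge0.
Qed.

(** After Tonelli, the Laplace mixture formula at each fixed [c], with [y] the scaled coordinate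
    [Y c]; the other coordinates only contribute the constant [rest]. *)
Lemma mixed_integral_mixture b w i0 : ~~ b i0 ->
  ((Num.sqrt pi / 2)%:E * mixed_integral V (set_true b i0) w =
   \int[mu]_r ((weight r)%:E * mixed_integral V b (shift w i0 r)))%E.
Proof.
move=> bi0.
pose Y c := expR (w ord0 i0) * (row_of_tuple c *m V) ord0 i0.
have mJ : measurable_fun setT (fun p : RT * d.-tuple RT =>
    (weight p.1 * expR (- potential V b (shift w i0 p.1) p.2))%:E).
  apply/measurable_EFinP; apply: measurable_funM.
    exact: (measurableT_comp measurable_weight measurable_fst).
  apply: (measurableT_comp (@measurable_expR R)); apply: measurable_funN.
  exact: measurable_potential_shift.
have J0 (p : RT * d.-tuple RT) :
    (0 <= (weight p.1 * expR (- potential V b (shift w i0 p.1) p.2))%:E)%E.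
  by rewrite lee_fin mulr_ge0// expR_ge0.
transitivity (\int[mu]_r \int[lebesgue_tuple d]_c
    (weight r * expR (- potential V b (shift w i0 r) c))%:E)%E; last first.
  apply: eq_integral => r _; under eq_integral do rewrite EFinM.
  rewrite ge0_integralZl//; first exact: measurable_exp_potential.
  by rewrite lee_fin expR_ge0.
rewrite (fubini_tonelli (fun p : RT * d.-tuple RT =>
  (weight p.1 * expR (- potential V b (shift w i0 p.1) p.2))%:E))//.
rewrite -ge0_integralZl//; last exact: measurable_exp_potential.
apply: eq_integral => c _.
pose rest := potential V (set_true b i0) w c - 2 * `|Y c|.
transitivity (\int[mu]_r ((expR (- rest))%:E *
    (expR (r - expR r ^+ 2 - (expR (- r) * Y c) ^+ 2))%:E))%E; last first.
  apply: eq_integral => r _; rewrite -EFinM -!expRD /= potential_shift// /rest /Y.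
  by rewrite normrM ger0_norm ?expR_ge0//; congr (expR _)%:E; ring.
rewrite ge0_integralZl//; last first.
  apply/measurable_EFinP; apply: (measurableT_comp (@measurable_expR R)).
  apply: measurable_funB.
    by apply: measurable_funB => //; apply: measurable_funX.
  apply: measurable_funX; apply: measurable_funM => //.
  exact: (measurableT_comp (@measurable_expR R)).
rewrite integral_laplace_mixture -!EFinM; congr EFin.
rewrite mulrCA -expRD; congr (_ * expR _); rewrite /rest; ring.
Qed.

Lemma log_concave_set_true b i0 : ~~ b i0 ->
  log_concave (fun w => fine (mixed_integral V b w)) ->
  log_concave (fun w => fine (mixed_integral V (set_true b i0) w)).
Proof.
move=> bi0 [P0 lcP].
have K0 : 0 < Num.sqrt pi / 2 :> R by rewrite divr_gt0// sqrtr_gt0 pi_gt0.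
(* Inverse of the constant in the mixture formula, so that the marginal of [Phi] is exactly the new
   integral. *)
pose K := (Num.sqrt pi / 2 : R)^-1.
have Kp : 0 < K by rewrite invr_gt0.
pose Phi w r := K * weight r * fine (mixed_integral V b (shift w i0 r)).
apply: (@log_concave_integral _ _ Phi).
- by move=> w r; rewrite mulr_ge0 ?P0// mulr_ge0 ?expR_ge0// ltW.
- move=> w; apply: measurable_funM.
    by apply: measurable_funM => //; exact: measurable_weight.
  apply/measurable_EFinP.
  rewrite (_ : EFin \o _ = fun r => mixed_integral V b (shift w i0 r)); last first.
    by apply/funext => r /=; rewrite fineK// mixed_integral_fin_num.
  exact: measurable_mixed_integral_shift.
- move=> s t x y a a01; have /andP[a0 a1] := a01.
  have lcP_shift : fine (mixed_integral V b (shift s i0 x)) `^ a *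
        fine (mixed_integral V b (shift t i0 y)) `^ (1 - a) <=
      fine (mixed_integral V b
        (shift (a *: s + (1 - a) *: t) i0 (a * x + (1 - a) * y))).
    apply: le_trans (lcP _ _ _ a01) _.
    (* [shift] is linear in w and r jointly, so it commutes with the convex combination. *)
    by rewrite /shift !scalerBr !scalerA addrACA -opprD -scalerDl.
  have lc_weight : (K * weight x) `^ a * (K * weight y) `^ (1 - a) <=
      K * weight (a * x + (1 - a) * y).
    rewrite powR_mean_mul ?expR_ge0 ?(ltW Kp)// -powRD; last first.
      by rewrite subrKC oner_eq0.
    rewrite subrKC powRr1 ?(ltW Kp)// ler_wpM2l ?(ltW Kp)//.
    exact: log_concave_weight.
  have W0 r : 0 <= K * weight r by rewrite mulr_ge0 ?expR_ge0// ltW.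
  rewrite /Phi powR_mean_mul; [|exact: W0|exact: P0|exact: W0|exact: P0].
  by apply: ler_pM lc_weight lcP_shift; rewrite mulr_ge0// powR_ge0.
move=> w.
transitivity (\int[mu]_r
    (K%:E * ((weight r)%:E * mixed_integral V b (shift w i0 r))))%E.
  apply: eq_integral => r _; rewrite /Phi !EFinM muleA fineK//.
  exact: mixed_integral_fin_num.
rewrite ge0_integralZl//; last 3 first.
- apply: emeasurable_funM; last exact: measurable_mixed_integral_shift.
  exact/measurable_EFinP.
- by move=> r _; rewrite mule_ge0// ?lee_fin ?expR_ge0// integral_ge0.
- by rewrite lee_fin ltW.
rewrite -mixed_integral_mixture// muleA -EFinM mulVf ?gt_eqF// mul1e fineK//.
exact: mixed_integral_fin_num.
Qed.

Theorem log_concave_mixed_integral_true :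
  log_concave (fun w => fine (mixed_integral V (fun=> true) w)).
Proof.
suff key k : (k <= n)%N ->
    log_concave
      (fun w => fine (mixed_integral V (fun i : 'I_n => (i < k)%N) w)).
  rewrite (_ : (fun=> true) = fun i : 'I_n => (i < n)%N); first exact: key.
  by apply/funext => i; rewrite ltn_ord.
elim: k => [_|k IH kn]; first exact: log_concave_gaussian.
rewrite (_ : (fun i : 'I_n => (i < k.+1)%N) =
    set_true (fun i : 'I_n => (i < k)%N) (Ordinal kn)); last first.
  apply/funext => i; rewrite /set_true ltnS leq_eqVlt.
  by congr orb.
by apply: log_concave_set_true; [rewrite /= ltnn|exact/IH/ltnW].
Qed.

End mixed_integral_log_concave.

(** * Volume of the sections *)

Section section_volume.
Context {R : realType} {d n : nat} (V : 'M[R]_(d, n)).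
Hypothesis VVT : V *m V^T = 1%:M.
Local Notation RT := (measurableTypeR R).
Local Notation mu := (@lebesgue_measure R).
Local Notation lambda := (@lebesgue_tuple R d).
Implicit Types (t : 'rV[R]_n) (c : d.-tuple RT).

(** The gauge of the scaled cross-polytope in the coordinates given by the rows of [V]. *)
Definition scaled_l1_norm t c : R :=
  \sum_i expR (- t ord0 i) * `|(row_of_tuple c *m V) ord0 i|.

Definition section_ball t (r : R) : set (d.-tuple RT) :=
  [set c | scaled_l1_norm t c <= r].

Lemma measurable_scaled_l1_norm t :
  measurable_fun setT (scaled_l1_norm t : _ -> RT).
Proof.
apply: measurable_sum => i; apply: measurable_funM => //.
by apply: measurableT_comp => //; exact: measurable_row_of_tuple_mulmx.
Qed.

Lemma measurable_section_ball t r : measurable (section_ball t r).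
Proof.
rewrite -[X in measurable X]setTI.
exact: (@measurable_fun_le _ _ R setT (scaled_l1_norm t) (cst r)
  measurableT (measurable_scaled_l1_norm t)).
Qed.

Lemma scaled_l1_normZ t (s : R) c : 0 <= s ->
  scaled_l1_norm t [tuple of map ( *%R s) c] = s * scaled_l1_norm t c.
Proof.
move=> s0; rewrite /scaled_l1_norm mulr_sumr; apply: eq_bigr => i _.
rewrite (_ : row_of_tuple _ = s *: row_of_tuple c); last first.
  by apply/rowP => j; rewrite !mxE tnth_map.
by rewrite -scalemxAl mxE normrM ger0_norm// mulrCA.
Qed.

Lemma section_ball_homogeneous t (r : R) : 0 < r ->
  (lambda (section_ball t r) = (r ^+ d)%:E * lambda (section_ball t 1))%E.
Proof.
move=> r0; have ri0 : 0 < r^-1 by rewrite invr_gt0.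
have -> : lambda (section_ball t r) = (\int[lambda]_c (\1_(section_ball t 1)
    [tuple of map ( *%R r^-1) c])%:E)%E.
  rewrite -(setIT (section_ball t r)) -integral_indic//; last first.
    exact: measurable_section_ball.
  apply: eq_integral => c _; rewrite !indicE; congr (_%:R)%:E; congr nat_of_bool.
  apply/idP/idP; rewrite !inE /section_ball/= scaled_l1_normZ ?(ltW ri0)//;
    by rewrite mulrC ler_pdivrMr// mul1r.
rewrite (ge0_integral_lebesgue_tuple_scale
  (f := fun c => (\1_(section_ball t 1) c)%:E))//.
  rewrite exprVn invrK integral_indic ?setIT//.
  exact: measurable_section_ball.
apply/measurable_EFinP; apply: measurable_indic.
exact: measurable_section_ball.
Qed.

(* K is finite, but this is not needed: if it were not, all the volumes would be
   0, since K times a volume is finite. *)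
Let K : \bar R := (\int[mu]_(s in `]0%R, 1%R[) (((- ln s) / 2) ^+ d)%:E)%E.

(** The superlevel set of exp(-2N) at height s, for N the gauge, is the ball of radius [- ln s / 2].
    Homogeneity takes the volume of the unit ball out of the layer cake integral and leaves [K],
    whose value is d!/2^d. *)
Lemma mixed_integral_section_volume t :
  mixed_integral V (fun=> true) (- t) = (K * lambda (section_ball t 1))%E.
Proof.
have pE c : potential V (fun=> true) (- t) c = 2 * scaled_l1_norm t c.
  rewrite /potential /cost mulr_sumr; apply: eq_bigr => i _.
  by rewrite mxE mulrA.
have p0 c : 0 <= scaled_l1_norm t c.
  by apply: sumr_ge0 => i _; rewrite mulr_ge0// expR_ge0.
have mE : measurable_fun setT
    (fun c : d.-tuple RT => expR (- potential V (fun=> true) (- t) c)).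
  by apply/measurable_EFinP; exact: measurable_exp_potential.
rewrite /mixed_integral.
transitivity (\int[lambda]_c
    (Num.min (expR (- potential V (fun=> true) (- t) c)) 1)%:E)%E.
  apply: eq_integral => c _; rewrite min_l// -expR0 ler_expR oppr_le0 pE.
  by rewrite mulr_ge0.
rewrite (layer_cake lambda mE); last by move=> c; exact: expR_ge0.
rewrite /K -ge0_integralZr//; last 2 first.
- apply/measurable_EFinP; apply: measurable_funX; apply: measurable_funM => //.
  by apply: measurable_funN; apply: measurable_funTS; exact: measurable_ln.
- move=> s /=; rewrite in_itv/= => /andP[s0 s1].
  by rewrite lee_fin exprn_ge0// divr_ge0// oppr_ge0 ln_le0// ltW.
apply: eq_integral => s; rewrite inE/= in_itv/= => /andP[s0 s1].
rewrite -section_ball_homogeneous; last first.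
  by rewrite divr_gt0// oppr_gt0 ln_lt0// s0.
have level (x : R) : (s <= expR (- (2 * x))) = (x <= - ln s / 2).
  by rewrite -{1}(@lnK _ s) ?posrE// ler_expR ler_pdivlMr// lerNr mulrC.
by congr (lambda _); apply/seteqP; split => c; rewrite /section_ball/= pE level.
Qed.

(** Positivity is what carries finiteness from the integral over to the volume. Below [expR (-2)]
    the radius [- ln s / 2] is at least 1, and hence so is the integrand. *)
Let K_gt0 : (0 < K)%E.
Proof.
have e1 : expR (-2) < 1 :> R by rewrite -[ltRHS]expR0 ltr_expR; lra.
apply: (@lt_le_trans _ _
  (\int[mu]_(s in `]0%R, (expR (-2) : R)[) (cst 1%E s))%E).
  rewrite integral_cst//= lebesgue_measure_itv/= lte_fin expR_gt0 mul1e sube0.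
  by rewrite lte_fin expR_gt0.
have mln : measurable_fun setT (fun s : RT => (((- ln s) / 2) ^+ d)%:E).
  apply/measurable_EFinP; apply: measurable_funX; apply: measurable_funM => //.
  by apply: measurable_funN; exact: measurable_ln.
apply: (@le_trans _ _
  (\int[mu]_(s in `]0%R, (expR (-2) : R)[) (((- ln s) / 2) ^+ d)%:E)%E).
  apply: ge0_le_integral => //.
  - exact: measurable_funTS.
  - move=> s /=; rewrite in_itv/= => /andP[s0 s1]; rewrite lee_fin exprn_ege1//.
    rewrite ler_pdivlMr// mul1r lerNr -[leRHS]expRK.
    by rewrite ler_ln ?posrE ?expR_gt0// ltW.
apply: ge0_subset_integral => //.
- exact: measurable_funTS.
- move=> s /=; rewrite in_itv/= => /andP[s0 s1].
  by rewrite lee_fin exprn_ge0// divr_ge0// oppr_ge0 ln_le0// ltW.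
- by apply: subset_itvl; rewrite bnd_simp ltW.
Qed.

Lemma log_concave_section_volume :
  (forall t, lambda (section_ball t 1) \is a fin_num) /\
  log_concave (fun t => fine (lambda (section_ball t 1))).
Proof.
have fin t : (K * lambda (section_ball t 1))%E \is a fin_num.
  by rewrite -mixed_integral_section_volume mixed_integral_fin_num.
have lfin t : lambda (section_ball t 1) \is a fin_num.
  rewrite ge0_fin_numE// ltey; apply/eqP => lE.
  by move: (fin t); rewrite lE gt0_muley.
split=> //.
have [Koo|Kfin] := eqVneq K +oo%E.
  have l0 t : lambda (section_ball t 1) = 0%E.
    apply/eqP; rewrite eq_le measure_ge0 andbT leNgt; apply/negP => l0.
    by move: (fin t); rewrite Koo gt0_mulye.
  rewrite (_ : (fun t => _) = fun=> 0); last by apply/funext => t; rewrite l0.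
  split=> // s t a /andP[a0 a1].
  by rewrite powR0 ?gt_eqF// mul0r.
have Kreal : K \is a fin_num by rewrite ge0_fin_numE ?ltW// ltey.
pose k := fine K; have k0 : 0 < k by rewrite fine_gt0// K_gt0 ltey.
have [I0 lcI] := log_concave_mixed_integral_true VVT.
have lE t : fine (lambda (section_ball t 1)) =
    k^-1 * fine (mixed_integral V (fun=> true) (- t)).
  by rewrite mixed_integral_section_volume fineM// mulKf// gt_eqF.
rewrite (_ : (fun t => _) =
  fun t => k^-1 * fine (mixed_integral V (fun=> true) (- t))); last first.
  by apply/funext => t; exact: lE.
have ki0 : 0 <= k^-1 by rewrite invr_ge0 ltW.
split=> [t|s t a a01]; first by rewrite mulr_ge0.
rewrite powR_mean_mul // -powRD; last by rewrite subrKC oner_eq0.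
rewrite subrKC powRr1// ler_wpM2l//; apply: le_trans (lcI _ _ _ a01) _.
by rewrite !scalerN -opprD.
Qed.

End section_volume.

(** * Passage to coordinates in an orthonormal basis *)

Section cross_polytope_section.
Context {R : realType} {n : nat} (H : {vspace 'rV[R]_n}).
Local Notation RT := (measurableTypeR R).

Definition basis_mx : 'M[R]_(\dim H, n) :=
  \matrix_(j, i) (tnth (onb H) j) ord0 i.

Lemma basis_mx_orthonormal : basis_mx *m basis_mx^T = 1%:M.
Proof.
have [_ oH] := onbP H; apply/matrixP => i j; rewrite !mxE -oH.
by apply: eq_bigr => k _; rewrite !mxE.
Qed.

Lemma row_of_tuple_basis (c : (\dim H).-tuple RT) :
  \sum_i tnth c i *: tnth (onb H) i = row_of_tuple c *m basis_mx.
Proof.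
apply/rowP => i; rewrite summxE mxE; apply: eq_bigr => j _.
by rewrite !mxE.
Qed.

Lemma vol_scaled_cross_polytope (t : 'rV[R]_n) :
  vol H (scaled_cross_polytope t `&` [set` H]) =
  lebesgue_tuple (\dim H) (section_ball basis_mx t 1).
Proof.
rewrite /vol; congr (lebesgue_tuple _ _); apply/seteqP; split => c /=;
  rewrite row_of_tuple_basis /section_ball /= /scaled_l1_norm.
  move=> [[x xB <-] _]; apply: le_trans xB; apply: ler_sum => i _.
  rewrite mul_mx_diag !mxE normrM (ger0_norm (expR_ge0 _)) mulrCA.
  by rewrite -expRD addNr expR0 mulr1.
move=> cB; split; last first.
  rewrite -row_of_tuple_basis; apply: memv_suml => i _; apply: memvZ.
  have [oH _] := onbP H.
  by have := memv_span (mem_tnth i (onb H)); rewrite oH.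
(* The preimage of the point under the diagonal matrix. *)
exists (\row_i (expR (- t ord0 i) * (row_of_tuple c *m basis_mx) ord0 i)).
  apply: le_trans cB; apply: ler_sum => i _.
  by rewrite mxE normrM (ger0_norm (expR_ge0 _)).
apply/rowP => i; rewrite mul_mx_diag !mxE mulrAC -expRD addNr expR0 mul1r.
by apply: eq_bigr => j _; rewrite !mxE.
Qed.

End cross_polytope_section.

(** The finiteness clause ensures that [fine] returns the actual volume. *)
Theorem theorem1 (R : realType) (n : nat) (H : {vspace 'rV[R]_n}) :
  (forall t : 'rV[R]_n,
     vol H (scaled_cross_polytope t `&` [set` H]) \is a fin_num) /\
  log_concave (fun t : 'rV[R]_n =>
    fine (vol H (scaled_cross_polytope t `&` [set` H]))).
Proof.
have [fin lc] := log_concave_section_volume (basis_mx_orthonormal H).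
split=> [t|]; first by rewrite vol_scaled_cross_polytope.
by under [fun t => _]funext do rewrite vol_scaled_cross_polytope.
Qed.
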